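(* Let $f$ be a non-negative Borel integrable function on $\mathbb{R}^n$, and let $c\in\mathbb{R}^n$ be a Yao-Yao center for the measure with density $f$ (with respect to Lebesgue measure). Then $c$ is a Santaló point for $f$ with respect to every weight $\rho$; that is, for every weight $\rho$ and every non-negative Borel function $g$ on $\mathbb{R}^n$ such that $$f(c+x)\,g(y)\leq \rho\bigl(\sqrt{x\cdot y}\bigr)^2\quad\text{for all } x,y\in\mathbb{R}^n \text{ with } x\cdot y\geq 0,$$ one has $$\int_{\mathbb{R}^n} f(x)\,dx\int_{\mathbb{R}^n} g(y)\,dy\leq\Bigl(\int_{\mathbb{R}^n}\rho(|x|)\,dx\Bigr)^2.$$
   Context: $x\cdot y$ is the standard scalar product and $|x|$ the Euclidean norm on $\mathbb{R}^n$. A weight is a measurable function $\rho:\mathbb{R}_+\to\mathbb{R}_+$ such that for every $n$ the function $x\in\mathbb{R}^n\mapsto\rho(|x|)$ is integrable. A set $\mathcal{P}$ of subsets of an affine space $E$ is a partition of $E$ if $\bigcup\mathcal{P}=E$ and the interiors of two distinct elements of $\mathcal{P}$ do not intersect. Yao-Yao partitions and their centers are defined by induction on the dimension of a finite-dimensional real affine space $E$ (with associated vector space $\vec{E}$): if $E=\{c\}$ has dimension $0$, then $\{\{c\}\}$ is a Yao-Yao partition of $E$ with center $c$. If $E$ has dimension $n\geq 1$, $\mathcal{P}$ is a Yao-Yao partition of $E$ if there exist an affine hyperplane $F$ of $E$, a vector $v\in\vec{E}\setminus\vec{F}$, and two Yao-Yao partitions $\mathcal{P}_+$, $\mathcal{P}_-$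 of $F$ having the same center $c$, such that $\mathcal{P}=\{A+\mathbb{R}_- v : A\in\mathcal{P}_-\}\cup\{A+\mathbb{R}_+ v : A\in\mathcal{P}_+\}$; the center of $\mathcal{P}$ is then $c$. For a finite Borel measure $\mu$ on $\mathbb{R}^n$ giving zero mass to every affine hyperplane, a Yao-Yao equipartition for $\mu$ is a Yao-Yao partition $\mathcal{P}$ of $\mathbb{R}^n$ with $\mu(A)=2^{-n}\mu(\mathbb{R}^n)$ for every $A\in\mathcal{P}$; a point $c$ is a Yao-Yao center of $\mu$ if it is the center of some Yao-Yao equipartition for $\mu$. *)

(* Defs.v *)
From HB Require Import structures.
From mathcomp Require Import all_boot all_order all_algebra.
From mathcomp Require Import all_classical all_reals all_analysis.

Set Implicit Arguments.
Unset Strict Implicit.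
Unset Printing Implicit Defensive.

Import Order.TTheory GRing.Theory Num.Theory.
Import numFieldNormedType.Exports.

Local Open Scope classical_set_scope.
Local Open Scope ring_scope.

Section Defs.
Context {R : realType}.

Definition dotp {n : nat} (x y : 'rV[R]_n) : R := \sum_(i < n) x ord0 i * y ord0 i.
Definition enorm {n : nat} (x : 'rV[R]_n) : R := Num.sqrt (dotp x x).

(** Identification of n.-tuples (which carry the product = Borel sigma-algebra
    of R^n in mathcomp-analysis) with row vectors. *)
Definition row_of_tuple {n : nat} (t : n.-tuple R) : 'rV[R]_n := \row_i tnth t i.

Definition borel_fun {n : nat} (f : 'rV[R]_n -> R) : Prop :=
  measurable_fun [set: n.-tuple R] (f \o row_of_tuple).

(** Lebesgue integral on R^n (for non-negative Borel functions), built as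
    the iterated integral with respect to the Lebesgue measure of R
    (equal to the integral against the n-fold product Lebesgue measure by
    Tonelli's theorem). *)
Fixpoint tuple_integral (n : nat) : (n.-tuple R -> \bar R) -> \bar R :=
  match n return (n.-tuple R -> \bar R) -> \bar R with
  | 0 => fun F => F [tuple]
  | m.+1 => fun F =>
      (\int[@lebesgue_measure R]_x tuple_integral (fun t => F (cons_tuple x t)))%E
  end.

Definition Rn_integral {n : nat} (F : 'rV[R]_n -> \bar R) : \bar R :=
  tuple_integral (F \o row_of_tuple).

Definition density_measure {n : nat} (f : 'rV[R]_n -> R) (A : set 'rV[R]_n) : \bar R :=
  Rn_integral (fun x => (f x * \1_A x)%:E).

(** Affine subspaces of R^n are represented as a + (row space of V),
    V : 'M_n a square matrix (whose row space is the direction). *)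
Definition aff_set {n : nat} (a : 'rV[R]_n) (V : 'M[R]_n) : set 'rV[R]_n :=
  [set x | (x - a <= V)%MS].

Definition cone_neg {n : nat} (A : set 'rV[R]_n) (v : 'rV[R]_n) : set 'rV[R]_n :=
  [set x + t *: v | x in A & t in [set t : R | t <= 0]].
Definition cone_pos {n : nat} (A : set 'rV[R]_n) (v : 'rV[R]_n) : set 'rV[R]_n :=
  [set x + t *: v | x in A & t in [set t : R | 0 <= t]].

(** yao_yao a V P c : P is a Yao-Yao partition of the affine space
    E = aff_set a V, with center c (inductive definition on the dimension). *)
Inductive yao_yao {n : nat} : 'rV[R]_n -> 'M[R]_n -> set (set 'rV[R]_n) -> 'rV[R]_n -> Prop :=
| yao_yao0 (a : 'rV[R]_n) (V : 'M[R]_n) :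
    \rank V = 0%N -> yao_yao a V [set [set a]] a
| yao_yaoS (a : 'rV[R]_n) (V : 'M[R]_n) (b : 'rV[R]_n) (W : 'M[R]_n)
    (v : 'rV[R]_n) (Pm Pp : set (set 'rV[R]_n)) (c : 'rV[R]_n) :
    (0 < \rank V)%N ->
    (* F = aff_set b W is an affine hyperplane of E = aff_set a V *)
    (b - a <= V)%MS -> (W <= V)%MS -> \rank W = (\rank V).-1 ->
    (v <= V)%MS -> ~~ (v <= W)%MS ->
    yao_yao b W Pm c -> yao_yao b W Pp c ->
    yao_yao a V ([set cone_neg A v | A in Pm] `|` [set cone_pos A v | A in Pp]) c.

Definition yao_yao_partition {n : nat} (P : set (set 'rV[R]_n)) (c : 'rV[R]_n) : Prop :=
  yao_yao 0 1%:M P c.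

Definition yao_yao_equipartition {n : nat} (mu : set 'rV[R]_n -> \bar R)
    (P : set (set 'rV[R]_n)) (c : 'rV[R]_n) : Prop :=
  yao_yao_partition P c /\
  forall A, P A -> mu A = (((2%:R : R) ^- n)%:E * mu setT)%E.

Definition yao_yao_center {n : nat} (mu : set 'rV[R]_n -> \bar R) (c : 'rV[R]_n) : Prop :=
  exists P, yao_yao_equipartition mu P c.

(** Weights. rho is only relevant on R_+ = [0, +oo). *)
Definition weight (rho : R -> R) : Prop :=
  measurable_fun (`[0%R, +oo[%classic : set R) rho /\
  (forall r, 0 <= r -> 0 <= rho r) /\
  (forall m : nat, (Rn_integral (fun x : 'rV[R]_m => (rho (enorm x))%:E) < +oo)%E).

End Defs.

(* Main.v *)
Require Import Defs.
From HB Require Import structures.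
From mathcomp Require Import all_boot all_order all_algebra.
From mathcomp Require Import all_classical all_reals all_analysis.
From mathcomp Require Import measurable_realfun ring lra.

Import Order.TTheory GRing.Theory Num.Theory.
Import numFieldNormedType.Exports.
Local Open Scope classical_set_scope.
Local Open Scope ring_scope.

(** The proof is by cutting space along the pieces of the partition. Each piece
    is a simplicial cone [c + pos(T)] spanned by the rows of an invertible matrix
    [T], and every half-space bounded through [c] contains a piece; equivalently
    the dual cones of the pieces cover the space. The linear maps [T] and
    [T^-t] send the positive orthant to a cone and to its dual, have inverse
    determinants and preserve the scalar product, so on each piece the claim
    reduces to a Prekopa-Leindler inequality on the orthant with coordinatewise
    geometric means: [F(v) G(w) <= H(sqrt(v w))^2] implies
    [int F * int G <= (int H)^2]. Summing over the [2^n] pieces, each of which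
    carries [2^-n int f], gives the theorem. The orthant inequality tensorizes,
    and in dimension one it follows from the Brunn-Minkowski inequality applied,
    in logarithmic coordinates, to the level sets of [x F(x)]. *)

(** * One-dimensional Lebesgue measure *)

Section affine.
Context {R : realType}.
Notation mu := (@lebesgue_measure R).

Lemma measurable_affine_preimage (a b : R) (A : set R) : measurable A ->
  measurable ((fun x : R => a * x + b) @^-1` A).
Proof.
move=> mA; rewrite -[X in measurable X]setTI.
suff: measurable_fun setT (fun x : R => a * x + b) by apply.
by apply: measurable_funD => //; apply: measurable_funM.
Qed.

Let aff (a b : R) (x : measurableTypeR R) : measurableTypeR R := a * x + b.

Let measurable_aff a b : measurable_fun setT (aff a b).
Proof.
by apply: measurable_funD => //; apply: measurable_funM.
Qed.

(** Built by tactic because the measure structure needs the measurability of [aff]; closed with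
    [Defined] so that its values still compute. *)
Let scaled_pushforward (a b : R) : {measure set (measurableTypeR R) -> \bar R}.
Proof.
refine (mscale (NngNum (normr_ge0 a)) (pushforward mu (aff a b)) :
  {measure set (measurableTypeR R) -> \bar R}).
exact: measurable_aff.
Defined.

(** By uniqueness of Lebesgue measure it is enough to compare both sides on intervals []x, y]]. For
    negative [a] the preimage is closed on the left instead of the right, which does not change its
    length. *)
Lemma lebesgue_measure_affine (a b : R) (A : set R) : a != 0 -> measurable A ->
  (mu A = `|a|%:E * mu ((fun x => a * x + b)%R @^-1` A))%E.
Proof.
move=> a0 mA.
pose nu := scaled_pushforward a b.
rewrite (_ : (`|a|%:E * _)%E = nu A)//.
apply: lebesgue_measure_unique => // X [[x y] _ <-].
rewrite /nu /= /mscale /= /pushforward lebesgue_measure_itv /=.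
have [a0'|a0'|/eqP] := ltgtP a 0; last by rewrite (negbTE a0).
  rewrite (_ : _ @^-1` _ = `[(y - b) / a, (x - b) / a[%classic); last first.
    apply/seteqP; split => z /=; rewrite !in_itv/= /aff.
      by rewrite ler_ndivrMr// ltr_ndivlMr//; lra.
    by rewrite ler_ndivrMr// ltr_ndivlMr//; lra.
  rewrite lebesgue_measure_itv/= !lte_fin.
  rewrite ltr_nM2r ?invr_lt0// ltrD2r.
  case: ifPn => xy; last by rewrite mule0.
  by rewrite ltr0_norm// -!EFinB -EFinM; congr EFin; field; rewrite lt_eqF.
rewrite (_ : _ @^-1` _ = `](x - b) / a, (y - b) / a]%classic); last first.
  apply/seteqP; split => z /=; rewrite !in_itv/= /aff.
    by rewrite ltr_pdivrMr// ler_pdivlMr//; lra.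
  by rewrite ltr_pdivrMr// ler_pdivlMr//; lra.
rewrite lebesgue_measure_itv/= !lte_fin.
rewrite ltr_pM2r ?invr_gt0// ltrD2r.
case: ifPn => xy; last by rewrite mule0.
by rewrite gtr0_norm// -!EFinB -EFinM; congr EFin; field; rewrite gt_eqF.
Qed.

Lemma ge0_integral_affine (a b : R) (F : R -> \bar R) : a != 0 ->
  measurable_fun setT F -> (forall x, 0 <= F x)%E ->
  (\int[mu]_x F (a * x + b)%R = `|a|^-1%:E * \int[mu]_x F x)%E.
Proof.
move=> a0 mF F0.
pose nu := scaled_pushforward a b.
rewrite [in RHS](@eq_measure_integral _ _ _ _ nu mu) => [|A mA _]; last first.
  exact: lebesgue_measure_affine.
rewrite ge0_integral_mscale//= muleA -EFinM mulVf ?normr_eq0// mul1e.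
apply/esym; exact: (ge0_integral_pushforward (measurable_aff a b) mu measurableT mF).
Qed.

End affine.

Section log_measure.
Context {R : realType}.
Notation mu := (@lebesgue_measure R).

(* The image under [ln] of the measure [dx / x]; the weight is written
   [expR (- ln x)] to be measurable on the whole line. *)
Definition log_measure (S : set (measurableTypeR R)) : \bar R :=
  (\int[mu]_(x in `]0%R, +oo[%classic `&` (@ln R) @^-1` S) (expR (- ln x))%:E)%E.

Let measurable_weight : measurable_fun setT (fun x : R => (expR (- ln x))%:E).
Proof.
apply/measurable_EFinP; apply: measurableT_comp => //.
exact: measurableT_comp.
Qed.

Let measurable_pre S : measurable S ->
  measurable (`]0%R, +oo[%classic `&` (@ln R) @^-1` S).
Proof.
move=> mS; apply: measurableI => //.
by rewrite -[X in measurable X]setTI; exact: measurable_ln.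
Qed.

Let log_measure0 : log_measure set0 = 0%E.
Proof. by rewrite /log_measure preimage_set0 setI0 integral_set0. Qed.

Let log_measure_ge0 S : (0 <= log_measure S)%E.
Proof. by apply: integral_ge0 => x _; rewrite lee_fin expR_ge0. Qed.

Let log_measure_sigma_additive : semi_sigma_additive log_measure.
Proof.
move=> F mF tF mUF; rewrite /log_measure; apply: cvg_toP.
  apply: ereal_nondecreasing_is_cvgn => m n mn.
  by apply: lee_sum_nneg_natr => // k _ _; exact: log_measure_ge0.
rewrite preimage_bigcup setI_bigcupr ge0_integral_bigcup//=.
- by move=> k; exact: (measurable_pre _ (mF k)).
- exact: (measurable_funTS measurable_weight).
- apply/trivIsetP => i j _ _ ij.
  rewrite setIACA setIid -preimage_setI.
  by move/trivIsetP : tF => /(_ _ _ _ _ ij) ->//; rewrite preimage_set0 setI0.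
Qed.

HB.instance Definition _ := isMeasure.Build _ _ _ log_measure
  log_measure0 log_measure_ge0 log_measure_sigma_additive.

(** On []a, b]] the integral of [1 / x] from [expR a] to [expR b] equals [b - a] by the fundamental
    theorem of calculus, and intervals determine Lebesgue measure. *)
Lemma log_measureE S : measurable S -> log_measure S = mu S.
Proof.
move=> mS; apply/esym.
apply: (@lebesgue_measure_unique R log_measure) => // X [[a b] _ <-] /=.
rewrite /log_measure lebesgue_measure_itv /= lte_fin.
have [ab|ba] := ltP a b; last first.
  have -> : `]a, b]%classic = set0 by rewrite set_itv_ge// -leNgt bnd_simp.
  by rewrite preimage_set0 setI0 integral_set0.
rewrite (_ : _ `&` _ = `]expR a, expR b]%classic); last first.
  apply/seteqP; split => x /=; rewrite !in_itv/=.
    rewrite andbT => -[x0]; rewrite -[x in _ -> _ < x <= _]lnK ?posrE//.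
    by rewrite ltr_expR ler_expR.
  move=> /andP[ax xb]; have x0 : 0 < x by rewrite (lt_trans (expR_gt0 a)).
  by split; rewrite ?x0// -ltr_expR -ler_expR lnK ?posrE// ax.
rewrite (eq_integral (fun x : measurableTypeR R => ((x : R)^-1)%:E)); last first.
  move=> x; rewrite inE/= in_itv/= => /andP[ax xb].
  have x0 : 0 < x by rewrite (lt_trans (expR_gt0 a)).
  by rewrite expRN lnK ?posrE.
have pos x : x \in `[expR a, expR b] -> 0 < x.
  by rewrite in_itv/= => /andP[ax xb]; rewrite (lt_le_trans (expR_gt0 a)).
have inv_cont : {within `[expR a, expR b], continuous (@GRing.inv R)}.
  apply: continuous_in_subspaceT => x /set_mem /= /pos x0.
  by apply: inv_continuous; rewrite gt_eqF.
rewrite integral_itv_obnd_cbnd; last first.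
  apply/measurable_EFinP.
  apply: (@measurable_funS _ _ _ _ `[expR a, expR b]%classic) => //.
    exact: subset_itv_oc_cc.
  exact: subspace_continuous_measurable_fun.
rewrite (@continuous_FTC2 _ _ (@ln R)) ?ltr_expR// ?expRK//.
- split => [x xab| |].
  + have := is_derive1_ln (pos x (subset_itv_oo_cc xab)).
    by move=> [].
  + by apply: cvg_at_right_filter; apply: continuous_ln; exact: expR_gt0.
  + by apply: cvg_at_left_filter; apply: continuous_ln; exact: expR_gt0.
- move=> x xab; rewrite derive1E.
  by have [_ ->] := is_derive1_ln (pos x (subset_itv_oo_cc xab)).
Qed.

End log_measure.

(** * The Brunn-Minkowski inequality on the line *)

Section brunn_minkowski.
Context {R : realType}.
Notation mu := (@lebesgue_measure R).

Let approach_from_below (S : \bar R) : S != -oo%E ->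
  exists u : nat -> R, [/\ nondecreasing_seq u, forall n, ((u n)%:E < S)%E
    & forall x, (x%:E < S)%E -> exists n, x <= u n].
Proof.
case: S => [s _|_|//].
- exists (fun n => s - n.+1%:R^-1); split=> [m n mn|n|x].
  + by rewrite lerB// lef_pV2 ?posrE// ler_nat.
  + by rewrite lte_fin ltrBlDr ltrDl invr_gt0.
  + rewrite lte_fin -subr_gt0 => xs.
    exists (Num.truncn (s - x)^-1); rewrite lerBrDr -lerBrDl.
    rewrite invf_ple ?posrE//.
    by rewrite ltW// truncnS_gt.
- exists (fun n => n%:R); split=> [m n mn|n|x _].
  + by rewrite ler_nat.
  + exact: ltry.
  + by exists (Num.truncn x).+1; rewrite ltW// truncnS_gt.
Qed.

(** The parts of [A] up to [u n], for [u] increasing to the supremum [S] of [A], each lie to the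
    left of some point of [A], hence have measure at most [K]. They exhaust [A] except possibly for
    the point [S], which is null. *)
Lemma lebesgue_measure_le_sup (A : set R) (K : \bar R) : measurable A ->
  A !=set0 -> (forall a, A a -> (mu (A `&` `]-oo, a[%classic) <= K)%E) ->
  (mu A <= K)%E.
Proof.
move=> mA [a0 Aa0] AK.
pose S := ereal_sup (EFin @` A).
have S0 : S != -oo%E.
  rewrite gt_eqF// (@lt_le_trans _ _ a0%:E) ?ltNyr//.
  by apply: ereal_sup_ubound; exists a0.
have [u [u_nd uS Su]] := approach_from_below S S0.
pose F n := A `&` `]-oo, u n]%classic.
have mF n : measurable (F n) by exact: measurableI.
have FK n : (mu (F n) <= K)%E.
  have [_ [a Aa <-] una] := ereal_sup_gt (uS n).
  apply: le_trans (AK _ Aa); apply: le_measure; rewrite ?inE//.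
  - exact: mF.
  - exact: measurableI.
  move=> x [Ax]; rewrite /= in_itv/= => xu; split=> //=.
  by rewrite in_itv/= (le_lt_trans xu)// -lte_fin.
have mUF : measurable (\bigcup_n F n) by exact: bigcupT_measurable.
have UFK : (mu (\bigcup_n F n) <= K)%E.
  have cF : mu (F n) @[n --> \oo] --> mu (\bigcup_n F n).
    apply: nondecreasing_cvg_mu => // m n mn; rewrite subsetEset.
    move=> x [Ax]; rewrite /= in_itv/= => xu; split=> //=.
    by rewrite in_itv/= (le_trans xu)// u_nd.
  rewrite -(cvg_lim _ cF)//; apply: lime_le; first by apply/cvg_ex; eexists; exact: cF.
  by near=> n; exact: FK.
apply: le_trans UFK.
(* If [S] is infinite, [fine S] is the default [0]: a harmless extra null point. *)
apply: (@le_trans _ _ (mu (\bigcup_n F n `|` [set fine S]))).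
  apply: le_measure; rewrite ?inE//; first exact: measurableU.
  move=> x Ax; have : (x%:E <= S)%E by apply: ereal_sup_ubound; exists x.
  rewrite le_eqVlt => /predU1P[<-|xS]; [by right|left].
  by have [n xn] := Su _ xS; exists n => //; split=> //=; rewrite in_itv.
have /le_trans := @measureU2 _ _ _ mu _ [set fine S] mUF (measurable_set1 _).
apply; rewrite [X in (_ + X)%E](lebesgue_measure_set1 (fine S)). by rewrite adde0.
Unshelve. all: end_near. Qed.

Lemma lebesgue_measure_shift (A : set R) (b : R) : measurable A ->
  mu ((fun x => x + b)%R @^-1` A) = mu A.
Proof.
move=> mA; rewrite (lebesgue_measure_affine 1 b A)// normr1 mul1e.
by congr (mu _); apply/seteqP; split => x /=; rewrite mul1r.
Qed.

(* [A] shifted by [b] and [B] shifted by [a] meet the two sides of [a + b],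
   so the parts of [A] below [a] and of [B] above [b] embed disjointly in [C]. *)
Lemma brunn_minkowski1 (A B C : set R) :
  measurable A -> measurable B -> measurable C -> A !=set0 -> B !=set0 ->
  (forall a b, A a -> B b -> C (a + b)) -> (mu A + mu B <= mu C)%E.
Proof.
move=> mA mB mC A0 B0 ABC.
have [->|Cfin] := eqVneq (mu C) +oo%E; first exact: leey.
have halves a b : A a -> B b ->
    (mu (A `&` `]-oo, a[%classic) + mu (B `&` `]b, +oo[%classic) <= mu C)%E.
  move=> Aa Bb.
  have mAa : measurable (A `&` `]-oo, a[%classic) by exact: measurableI.
  have mBb : measurable (B `&` `]b, +oo[%classic) by exact: measurableI.
  have mshift E r : measurable E -> measurable ((fun x : R => x + r) @^-1` E).
    move=> mE; rewrite -[X in measurable X]setTI.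
    by apply: (@measurable_funD _ _ _ _ id (cst r)).
  rewrite -(lebesgue_measure_shift _ (- b) mAa).
  rewrite -(lebesgue_measure_shift _ (- a) mBb) -measureU; last 3 first.
  - exact: mshift.
  - exact: mshift.
  - rewrite -subset0 => x [[_ /=] + [_ /=]]; rewrite !in_itv/=; lra.
  apply: le_measure; rewrite ?inE//; first by apply: measurableU; exact: mshift.
  move=> x /= [[Axb _]|[Bxa _]].
    by rewrite -(subrK b x); exact: ABC.
  by rewrite -(subrK a x) addrC; exact: ABC.
(* Once [mu C] is finite, the measures bounded by it are finite too, so they can be moved across the
   inequalities while one half-line at a time is let grow. *)
have mueN (D : set R) : (mu D <= mu C -> mu D \is a fin_num)%E.
  move=> DC; rewrite ge0_fin_numE//; apply: le_lt_trans DC _.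
  by rewrite ltey.
have up b : B b -> (mu A + mu (B `&` `]b, +oo[%classic) <= mu C)%E.
  move=> Bb; have [a Aa] := A0.
  have fB : mu (B `&` `]b, +oo[%classic) \is a fin_num.
    by apply: mueN; apply: le_trans (halves _ _ Aa Bb); rewrite leeDr.
  rewrite -leeBrDr//; apply: lebesgue_measure_le_sup => // a' Aa'.
  by rewrite leeBrDr//; exact: halves.
have [b Bb] := B0.
have fA : mu A \is a fin_num.
  by apply: mueN; apply: le_trans (up _ Bb); rewrite leeDl.
rewrite -leeBrDl//.
(* The half-lines above [b] become half-lines below a point under the reflection [x -> - x], so that
   [lebesgue_measure_le_sup] applies to [B] as well. *)
have opp1 : (-1 : R) != 0 by rewrite oppr_eq0.
have muopp (E : set R) : measurable E ->
    mu E = mu ((fun x => -1 * x + 0)%R @^-1` E).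
  by move=> mE; rewrite {1}(lebesgue_measure_affine (-1) 0 E)// normrN1 mul1e.
rewrite muopp//; apply: lebesgue_measure_le_sup; first exact: measurable_affine_preimage.
  by exists (- b) => /=; rewrite mulN1r opprK addr0.
move=> x Bx; rewrite leeBrDl//; apply: le_trans (up _ Bx).
rewrite leeD2l// [leRHS]muopp; last exact: measurableI.
apply: le_measure; rewrite ?inE//.
- by apply: measurableI => //; exact: measurable_affine_preimage.
- by apply: measurable_affine_preimage; exact: measurableI.
- move=> y [By /=]; rewrite in_itv/= => yx; split=> //=.
  by rewrite in_itv/= andbT; move: yx; lra.
Qed.

Lemma brunn_minkowski1_half (A B C : set R) :
  measurable A -> measurable B -> measurable C -> A !=set0 -> B !=set0 ->
  (forall a b, A a -> B b -> C ((a + b) / 2)) ->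
  (mu A + mu B <= 2%:E * mu C)%E.
Proof.
move=> mA mB mC A0 B0 ABC.
have h0 : (2^-1 : R) != 0 by rewrite invr_eq0.
rewrite (lebesgue_measure_affine 2^-1 0 C)// muleA -EFinM.
rewrite ger0_norm ?invr_ge0// divff// mul1e.
apply: brunn_minkowski1 => //.
  exact: measurable_affine_preimage.
by move=> a b Aa Bb /=; rewrite addr0 mulrC; exact: ABC.
Qed.

End brunn_minkowski.

(** * Level sets in logarithmic coordinates and the layer-cake formula *)

Section level_sets.
Context {R : realType}.
Notation mu := (@lebesgue_measure R).
Implicit Types F G H : R -> \bar R.

(** With [x = expR s] one has [dx = expR s ds], so the density of [F] in the variable [s] carries
    the factor [expR s]; these are its strict superlevel sets. *)
Definition log_level F (t : R) : set R :=
  [set s | (t%:E < (expR s)%:E * F (expR s))%E].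

Lemma measurable_lt_level d (T : measurableType d) (F : R -> \bar R)
    (u v : T -> R) : measurable_fun setT F ->
  measurable_fun setT u -> measurable_fun setT v ->
  measurable [set p | ((u p)%:E < (v p)%:E * F (v p))%E].
Proof.
move=> mF mu' mv; rewrite -[X in measurable X]setTI.
apply: measurable_lte => //; first exact/measurable_EFinP.
apply: emeasurable_funM; first exact/measurable_EFinP.
exact: measurableT_comp.
Qed.

Lemma measurable_log_level F t : measurable_fun setT F ->
  measurable (log_level F t).
Proof. by move=> mF; apply: measurable_lt_level. Qed.

Lemma measurable_lebesgue_log_level F : measurable_fun setT F ->
  measurable_fun setT (fun t => mu (log_level F t)).
Proof.
move=> mF.
(* The level sets are the sections of one measurable set of the plane, whose measures depend
   measurably on the abscissa. *)
pose E := [set p : R * R | (p.1%:E < (expR p.2)%:E * F (expR p.2))%E].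
have mE : measurable E.
  by apply: measurable_lt_level => //; exact: measurableT_comp.
have := measurable_fun_xsection mu mE.
congr measurable_fun; apply/funext => t /=; congr (mu _).
by apply/seteqP; split => s /=; rewrite xsectionE.
Qed.

Lemma lebesgue_measure_pos_lt (c : \bar R) : (0 <= c)%E ->
  mu [set t | 0 < t /\ (t%:E < c)%E] = c.
Proof.
case: c => [c c0|_|//].
- rewrite (_ : [set t | _] = `]0, c[%classic); last first.
    apply/seteqP; split => t /=; rewrite in_itv/= lte_fin.
      by move=> [-> ->].
    by move=> /andP[].
  rewrite lebesgue_measure_itv/= lte_fin; move: c0; rewrite lee_fin le_eqVlt.
  by move=> /predU1P[<-|->]; rewrite ?ltxx// oppr0 adde0.
- rewrite (_ : [set t | _] = `]0, +oo[%classic); last first.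
    apply/seteqP; split => t /=; rewrite in_itv/= andbT.
      by move=> [].
    by move=> ->; rewrite ltry.
  by rewrite lebesgue_measure_itv/= ltry.
Qed.

(* Integrates [e^(- ln x) = 1 / x] over [0 < x], [0 < t < x F(x)] in both orders. *)
Lemma layer_cake_log F : measurable_fun setT F -> (forall x, 0 <= F x)%E ->
  (\int[mu]_(x in `]0%R, +oo[) F x =
   \int[mu]_(t in `]0%R, +oo[) mu (log_level F t))%E.
Proof.
move=> mF F0.
pose E := [set p : R * R | 0 < p.1] `&` [set p : R * R | 0 < p.2] `&`
  [set p : R * R | (p.2%:E < p.1%:E * F p.1)%E].
have mpos (u : R * R -> R) : measurable_fun setT u ->
    measurable [set p | 0 < u p].
  move=> mu'; rewrite (_ : [set p | _] = u @^-1` `]0, +oo[%classic).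
    by rewrite -[X in measurable X]setTI; exact: mu'.
  by apply/seteqP; split => p /=; rewrite in_itv/= andbT.
have mE : measurable E.
  apply: measurableI; last exact: measurable_lt_level.
  by apply: measurableI; exact: mpos.
pose Phi p := (\1_E p * expR (- ln p.1))%:E.
have mPhi : measurable_fun setT Phi.
  apply/measurable_EFinP; apply: measurable_funM; first exact: measurable_indic.
  apply: measurableT_comp => //; apply: measurableT_comp => //.
  exact: measurableT_comp.
have Phi0 p : (0 <= Phi p)%E by rewrite lee_fin mulr_ge0// expR_ge0.
have := @fubini_tonelli _ _ _ _ _ mu mu Phi mPhi Phi0.
rewrite [RHS](_ : _ = \int[mu]_(t in `]0%R, +oo[) mu (log_level F t))%E; last first.
  rewrite [RHS]integral_mkcond; apply: eq_integral => t _.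
  rewrite patchE; case: ifPn => t0; last first.
    rewrite integral0_eq// => x _; rewrite /Phi indicE memNset ?mul0r//.
    by move=> [[_ /= p2] _]; move: t0; rewrite notin_setE/= in_itv/= p2.
  rewrite -log_measureE; last exact: measurable_log_level.
  rewrite /log_measure [RHS]integral_mkcond; apply: eq_integral => x _.
  rewrite patchE /Phi indicE.
  move: t0; rewrite inE/= in_itv/= andbT => t0.
  have -> : ((x, t) \in E) = (x \in `]0%R, +oo[%classic `&` (@ln R) @^-1` log_level F t).
    apply/idP/idP; rewrite !inE /E /log_level /= in_itv/= andbT.
      by move=> [[x0 _]]; rewrite lnK ?posrE.
    by move=> [x0]; rewrite lnK ?posrE.
  by case: ifPn; rewrite ?mul1r ?mul0r.
move=> <-.
rewrite [LHS]integral_mkcond; apply: eq_integral => x _.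
rewrite patchE; case: ifPn => x0; last first.
  rewrite integral0_eq// => t _; rewrite /Phi indicE memNset ?mul0r//.
  by move=> [[/= p1 _] _]; move: x0; rewrite notin_setE/= in_itv/= p1.
move: x0; rewrite inE/= in_itv/= andbT => x0.
pose S := [set t : R | 0 < t /\ (t%:E < x%:E * F x)%E].
have mS : measurable S.
  rewrite (_ : S = xsection E x); first exact: measurable_xsection.
  apply/seteqP; split => t; rewrite xsectionE /E/=; first by move=> [].
  by move=> [[]].
transitivity (\int[mu]_t ((expR (- ln x))%:E * (\1_S t)%:E))%E; last first.
  apply: eq_integral => t _; rewrite /Phi -EFinM mulrC /= !indicE.
  suff -> : ((x, t) \in E) = (t \in S) by [].
  apply/idP/idP; rewrite !inE /E /S /=; first by move=> [[]].
  by move=> [].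
rewrite ge0_integralZl ?lee_fin ?expR_ge0//; last first.
  by apply/measurable_EFinP; exact: measurable_indic.
rewrite integral_indic// setIT.
rewrite [X in (_ * X)%E](_ : _ = x%:E * F x)%E; last first.
  by apply: lebesgue_measure_pos_lt; rewrite mule_ge0// lee_fin ltW.
by rewrite expRN lnK ?posrE// muleA -EFinM mulVf ?gt_eqF// mul1e.
Qed.

End level_sets.

(** * The multiplicative Prekopa-Leindler inequality *)

Section multiplicative_prekopa_leindler.
Context {R : realType}.
Notation mu := (@lebesgue_measure R).
Implicit Types F G H : R -> \bar R.

Lemma ge0_integral_scale_itv (phi : R -> \bar R) (c : R) : 0 < c ->
  measurable_fun setT phi -> (forall x, 0 <= phi x)%E ->
  (\int[mu]_(t in `]0%R, c[) phi t =
   c%:E * \int[mu]_(r in `]0%R, 1%R[) phi (c * r)%R)%E.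
Proof.
move=> c0 mphi phi0; pose psi := phi \_ `]0%R, c[%classic.
have mpsi : measurable_fun setT psi.
  by apply/(measurable_restrictT phi) => //; exact: measurable_funTS.
have psi0 x : (0 <= psi x)%E by exact: erestrict_ge0.
rewrite [LHS]integral_mkcond [in RHS]integral_mkcond.
rewrite [X in (_ * X)%E](_ : _ = \int[mu]_x psi (c * x + 0)%R)%E; last first.
  apply: eq_integral => x _; rewrite /psi !patchE addr0.
  rewrite (_ : (_ \in `]0, c[%classic) = (x \in `]0%R, 1%R[%classic))//.
  by rewrite !mem_setE !in_itv/= pmulr_rgt0// -ltr_pdivlMl// mulVf// gt_eqF.
rewrite (ge0_integral_affine c 0 psi)// ?gt_eqF// gtr0_norm//.
by rewrite muleA -EFinM divff ?gt_eqF// mul1e.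
Qed.

(** The Brunn-Minkowski inequality fails for an empty summand, so it can be used only at levels that
    are exceeded somewhere. *)
Let good F (a : R) := forall r : R, 0 < r -> r < a -> log_level F r !=set0.

Let log_level_eq0 F t : ~ (log_level F t !=set0) -> mu (log_level F t) = 0%E.
Proof. by move/set0P/negP/negPn/eqP ->; rewrite measure0. Qed.

(** With [M] the supremum of [x * F x] over positive [x], the level sets are nonempty exactly below
    [M]. For finite positive [M] the choice [a = M] captures the whole integral; for infinite [M]
    monotone convergence along the integers does; for [M <= 0] the integral vanishes. *)
Let integral_log_level_le F (c L : \bar R) : measurable_fun setT F ->
  (0 <= c)%E -> (0 <= L)%E ->
  (forall a, 0 < a -> good F a ->
    (c * \int[mu]_(t in `]0%R, a[) mu (log_level F t) <= L)%E) ->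
  (c * \int[mu]_(t in `]0%R, +oo[) mu (log_level F t) <= L)%E.
Proof.
move=> mF c0 L0 cL.
pose M := ereal_sup (range (fun s => (expR s)%:E * F (expR s))%E).
have levelM r : (r%:E < M)%E -> log_level F r !=set0.
  by move=> /ereal_sup_gt[_ [s _ <-] rs]; exists s.
have Mlevel r : log_level F r !=set0 -> (r%:E < M)%E.
  by move=> [s /= /lt_le_trans]; apply; apply: ereal_sup_ubound; exists s.
have ml := measurable_lebesgue_log_level F mF.
have [Moo|Moo] := eqVneq M +oo%E.
  have goodn a : good F a by move=> r _ _; apply: levelM; rewrite Moo ltry.
  rewrite -ge0_integralZl//; last exact: measurable_funTS.
  have -> : `]0%R, +oo[%classic = \bigcup_n `]0%R, (n.+1%:R : R)[%classic.
    apply/seteqP; split=> x /=; rewrite in_itv/= ?andbT.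
      move=> x0; exists (Num.truncn x) => //=.
      by rewrite in_itv/= x0 Num.Theory.truncnS_gt.
    by move=> [n _] /=; rewrite in_itv/= => /andP[->].
  have cvgn : (\int[mu]_(x in `]0%R, (n.+1%:R : R)[) (c * mu (log_level F x)) @[n --> \oo]
      --> \int[mu]_(x in \bigcup_n `]0%R, (n.+1%:R : R)[%classic) (c * mu (log_level F x)))%E.
    apply: ge0_nondecreasing_set_cvg_integral => //.
    - move=> m n mn; rewrite subsetEset => x /=; rewrite !in_itv/=.
      by move=> /andP[->] /lt_le_trans; apply; rewrite ler_nat.
    - by move=> n; apply: measurable_funTS; exact: measurable_funeM.
    - by move=> n x _; rewrite mule_ge0.
  rewrite -(cvg_lim _ cvgn)//; apply: lime_le; first by apply/cvg_ex; eexists; exact: cvgn.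
  near=> n; rewrite ge0_integralZl//; last exact: measurable_funTS.
  exact: cL.
have [M0|M0] := leP M 0%E.
  rewrite integral0_eq ?mule0// => t /=; rewrite in_itv/= andbT => t0.
  apply: log_level_eq0 => /Mlevel; apply/negP; rewrite -leNgt.
  by rewrite (le_trans M0)// lee_fin ltW.
have Mfin : M \is a fin_num by rewrite gt0_fin_numE// ltey.
have fM0 : 0 < fine M by rewrite -lte_fin fineK.
rewrite (_ : (\int[mu]_(t in _) _ = \int[mu]_(t in `]0%R, fine M[) mu (log_level F t))%E).
  by apply: cL => // r _ rM; apply: levelM; rewrite -(fineK Mfin) lte_fin.
rewrite [LHS]integral_mkcond [RHS]integral_mkcond; apply: eq_integral => t _.
rewrite !patchE !mem_setE !in_itv/= andbT.
have [t0|//] := ltP 0 t; case: ltP => //= Mt.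
apply: log_level_eq0 => /Mlevel; apply/negP; rewrite -leNgt.
by rewrite -(fineK Mfin) lee_fin.
Unshelve. all: end_near. Qed.

Section inequality.
Variables F G H : R -> \bar R.
Hypotheses (mF : measurable_fun setT F) (mG : measurable_fun setT G)
  (mH : measurable_fun setT H).
Hypotheses (F0 : forall x, (0 <= F x)%E) (G0 : forall x, (0 <= G x)%E)
  (H0 : forall x, (0 <= H x)%E).
Hypothesis FGH : forall x y, 0 < x -> 0 < y ->
  (F x * G y <= H (Num.sqrt (x * y)) ^+ 2)%E.

(** In logarithmic coordinates the geometric mean is the midpoint. If [x F(x) > s] and [y G(y) > t],
    multiplying and using [FGH] gives [z H(z) > sqrt(s t)] at [z = sqrt(x y)], so the midpoint form
    of Brunn-Minkowski applies. *)
Let level_ineq s t : 0 < s -> 0 < t ->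
  log_level F s !=set0 -> log_level G t !=set0 ->
  (mu (log_level F s) + mu (log_level G t) <=
   2%:E * mu (log_level H (Num.sqrt (s * t))))%E.
Proof.
move=> s0 t0 Fs Gt; apply: brunn_minkowski1_half => //; try exact: measurable_log_level.
move=> x y; rewrite /log_level /= => sx ty.
have sqrt_exp : expR ((x + y) / 2) = Num.sqrt (expR x * expR y).
  rewrite -expRD -[in RHS](divfK (_ : 2 != 0) (x + y))// mulr2n mulrDr mulr1 expRD.
  by rewrite -expr2 sqrtr_sqr ger0_norm// expR_ge0.
(* Both sides are nonnegative, so the comparison is made between their squares, where the square
   roots disappear. *)
rewrite sqrt_exp ltNge -lee_sqr ?mule_ge0// ?lee_fin ?sqrtr_ge0// -ltNge.
rewrite -EFin_expe sqr_sqrtr ?mulr_ge0 ?ltW//.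
rewrite EFinM; apply: lt_le_trans (lte_pmul _ _ sx ty) _.
- by rewrite lee_fin ltW.
- by rewrite lee_fin ltW.
rewrite muleACA expe2 [leRHS]muleACA -!EFinM -expr2 sqr_sqrtr ?mulr_ge0 ?expR_ge0//.
by rewrite EFinM lee_pmul2l ?fin_numM// ?FGH ?expR_gt0// lte_fin ?mulr_gt0 ?expR_gt0.
Qed.

(** Rescaling the levels to [a * r] and [b * r] with [r] in []0, 1[] keeps both level sets nonempty
    for the same [r], and their geometric mean is [c * r] with [c = sqrt(a b)]. Integrating
    [level_ineq] over [r] gives [I / a + J / b <= 2 K / c], and the arithmetic-geometric mean
    inequality concludes. *)
Let bounded_ineq a b : 0 < a -> 0 < b -> good F a -> good G b ->
  (\int[mu]_(t in `]0%R, a[) mu (log_level F t) *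
   \int[mu]_(t in `]0%R, b[) mu (log_level G t) <=
   (\int[mu]_(t in `]0%R, +oo[) mu (log_level H t)) ^+ 2)%E.
Proof.
move=> a0 b0 Fa Gb.
set I := (\int[mu]_(t in _) mu (log_level F t))%E.
set J := (\int[mu]_(t in _) mu (log_level G t))%E.
set K := (\int[mu]_(t in _) mu (log_level H t))%E.
pose c := Num.sqrt (a * b).
have c0 : 0 < c by rewrite sqrtr_gt0 mulr_gt0.
have cE : c ^+ 2 = a * b by rewrite sqr_sqrtr// ltW// mulr_gt0.
have I0 : (0 <= I)%E by exact: integral_ge0.
have J0 : (0 <= J)%E by exact: integral_ge0.
have K0 : (0 <= K)%E by exact: integral_ge0.
have mscale (E : R -> \bar R) (r : R) : measurable_fun setT E ->
    measurable_fun setT (fun t : R => mu (log_level E (r * t))).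
  move=> mE; apply: (measurableT_comp (measurable_lebesgue_log_level E mE)).
  exact: mulrl_measurable.
have scaleK : (\int[mu]_(r in `]0%R, 1%R[) mu (log_level H (c * r)) <= c^-1%:E * K)%E.
  rewrite -(@lee_pmul2l _ c%:E)// muleA -EFinM divff ?gt_eqF// mul1e.
  rewrite -(ge0_integral_scale_itv (fun t => mu (log_level H t)))//; last first.
    exact: measurable_lebesgue_log_level.
  apply: ge0_subset_integral => //.
    by apply: measurable_funTS; exact: measurable_lebesgue_log_level.
  by move=> x /=; rewrite !in_itv/= => /andP[->].
have key : (a^-1%:E * I + b^-1%:E * J <= 2%:E * (c^-1%:E * K))%E.
  rewrite /I /J (ge0_integral_scale_itv (fun t => mu (log_level F t)) a)//; last first.
    exact: measurable_lebesgue_log_level.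
  rewrite (ge0_integral_scale_itv (fun t => mu (log_level G t)) b)//; last first.
    exact: measurable_lebesgue_log_level.
  rewrite !muleA -!EFinM !mulVf ?gt_eqF// !mul1e.
  rewrite -ge0_integralD//; try by apply: measurable_funTS; exact: mscale.
  apply: (@le_trans _ _ (2%:E * \int[mu]_(r in `]0%R, 1%R[) mu (log_level H (c * r)))%E).
    rewrite -ge0_integralZl//; last by apply: measurable_funTS; exact: mscale.
    apply: ge0_le_integral => //.
    - by move=> x _; exact: adde_ge0.
    - by apply: emeasurable_funD; apply: measurable_funTS; exact: mscale.
    - by apply: measurable_funeM; apply: measurable_funTS; exact: mscale.
    - move=> r; rewrite /= in_itv/= => /andP[r0 r1].
      have -> : c * r = Num.sqrt (a * r * (b * r)).
        rewrite mulrACA -expr2 sqrtrM; last by rewrite ltW// mulr_gt0.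
        by rewrite sqrtr_sqr gtr0_norm.
      apply: level_ineq; rewrite ?mulr_gt0//.
        by apply: Fa; rewrite ?mulr_gt0// gtr_pMr.
      by apply: Gb; rewrite ?mulr_gt0// gtr_pMr.
  by rewrite EFinM -muleA lee_pmul2l.
have [->|Kfin] := eqVneq K +oo%E; first by rewrite expe2 mulyy leey.
have {}Kfin : K \is a fin_num by rewrite ge0_fin_numE// ltey.
have rfin : (2%:E * (c^-1%:E * K) < +oo)%E by rewrite ltey_eq !fin_numM.
(* Finiteness of [K] passes through [key] to [I] and [J], so the rest is an inequality between real
   numbers. *)
have bound r (X : \bar R) : 0 < r -> (0 <= X)%E ->
    (r^-1%:E * X <= 2%:E * (c^-1%:E * K))%E -> X \is a fin_num.
  move=> r0 X0 /le_lt_trans/(_ rfin); move: X0.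
  by case: X => // _; rewrite gt0_muley ?lte_fin ?invr_gt0.
have Ifin : I \is a fin_num.
  apply: (bound a) => //; apply: le_trans key; rewrite leeDl//.
  by rewrite mule_ge0// lee_fin invr_ge0 ltW.
have Jfin : J \is a fin_num.
  apply: (bound b) => //; apply: le_trans key; rewrite leeDr//.
  by rewrite mule_ge0// lee_fin invr_ge0 ltW.
move: key I0 J0 K0; rewrite -(fineK Ifin) -(fineK Jfin) -(fineK Kfin).
rewrite -!EFinM -EFinD -EFin_expe !lee_fin.
move: (fine I) (fine J) (fine K) => i j k key i0 j0 k0.
pose p := a^-1 * i; pose q := b^-1 * j.
have -> : i * j = c ^+ 2 * (p * q).
  by rewrite cE /p /q; field; rewrite !gt_eqF.
have pqk : c * (p + q) <= 2 * k.
  by rewrite mulrC -ler_pdivlMr// mulrC mulrCA.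
have pq0 : 0 <= p + q by rewrite addr_ge0// mulr_ge0// invr_ge0 ltW.
have : (c * (p + q)) ^+ 2 <= (2 * k) ^+ 2.
  by rewrite ler_sqr ?nnegrE ?mulr_ge0// ltW.
(* This square supplies [4 p q <= (p + q)^2], scaled by [c^2]. *)
have := sqr_ge0 (c * (p - q)); nra.
Qed.

Theorem multiplicative_prekopa_leindler1 :
  (\int[mu]_(x in `]0%R, +oo[) F x * \int[mu]_(x in `]0%R, +oo[) G x <=
   (\int[mu]_(x in `]0%R, +oo[) H x) ^+ 2)%E.
Proof.
rewrite (layer_cake_log F mF F0) (layer_cake_log G mG G0) (layer_cake_log H mH H0).
have K2 : (0 <= (\int[mu]_(t in `]0%R, +oo[) mu (log_level H t)) ^+ 2)%E.
  by apply: expe_ge0; exact: integral_ge0.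
(* The levels are truncated for [G] first and then for [F], each time with the other integral as the
   constant factor. *)
apply: (integral_log_level_le G _ _ mG _ K2) => [|b b0 Gb]; first exact: integral_ge0.
rewrite muleC; apply: (integral_log_level_le F _ _ mF _ K2) => [|a a0 Fa].
  exact: integral_ge0.
by rewrite muleC; exact: bounded_ineq.
Qed.

End inequality.
End multiplicative_prekopa_leindler.

(** * Iterated integrals of functions of a row vector *)

Section row_integral.
Context {R : realType}.
Notation mu := (@lebesgue_measure R).

Definition cons_row n (x : R) (v : 'rV[R]_n) : 'rV[R]_n.+1 :=
  row_mx (x%:M : 'M[R]_1) v.

Lemma cons_row0 n x (v : 'rV[R]_n) : cons_row n x v ord0 ord0 = x.
Proof.
rewrite (_ : ord0 = lshift n (ord0 : 'I_1)); last exact/val_inj.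
by rewrite /cons_row (row_mxEl (n1 := 1)) mxE mulr1n.
Qed.

Lemma cons_rowS n x (v : 'rV[R]_n) i : cons_row n x v ord0 (lift ord0 i) = v ord0 i.
Proof.
rewrite (_ : lift ord0 i = rshift 1 i); last exact/val_inj.
by rewrite /cons_row (row_mxEr (n1 := 1)).
Qed.

(** The iterated integral over the power [D^n]: the whole line gives the integral over the space, a
    half-line the integral over an orthant. *)
Fixpoint row_integral (D : set R) (n : nat) : ('rV[R]_n -> \bar R) -> \bar R :=
  match n return ('rV[R]_n -> \bar R) -> \bar R with
  | 0 => fun F => F 0
  | m.+1 => fun F =>
      (\int[mu]_(x in D) row_integral D m (fun v => F (cons_row m x v)))%E
  end.

Lemma row_of_tuple_cons n x (t : n.-tuple R) :
  row_of_tuple (cons_tuple x t) = cons_row n x (row_of_tuple t).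
Proof.
apply/rowP => i; rewrite mxE; case: (unliftP ord0 i) => [j|] ->.
  by rewrite cons_rowS mxE tnthS.
by rewrite cons_row0.
Qed.

Lemma eq_row_integral D n (F G : 'rV[R]_n -> \bar R) : F =1 G ->
  row_integral D n F = row_integral D n G.
Proof. by move=> /funext ->. Qed.

Lemma Rn_integralE n (F : 'rV[R]_n -> \bar R) :
  Rn_integral F = row_integral setT n F.
Proof.
rewrite /Rn_integral; elim: n F => [|n IH] F /=.
  by rewrite [row_of_tuple _]thinmx0.
apply: eq_integral => x _; rewrite -IH; congr tuple_integral.
by apply/funext => t /=; rewrite row_of_tuple_cons.
Qed.

Lemma row_integral_ge0 D n (F : 'rV[R]_n -> \bar R) : (forall v, 0 <= F v)%E ->
  (0 <= row_integral D n F)%E.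
Proof.
elim: n F => [|n IH] F F0 /=; first exact: F0.
by apply: integral_ge0 => x _; exact: IH.
Qed.

(** Measurability into row vectors is taken coordinatewise, which amounts to measurability of the
    corresponding tuple. *)
Definition measurable_row d (T : measurableType d) n (phi : T -> 'rV[R]_n) :=
  forall i, measurable_fun setT (fun t => phi t ord0 i).

Lemma measurable_row_comp d (T : measurableType d) d' (U : measurableType d') n
    (F : 'rV[R]_n -> U) (phi : T -> 'rV[R]_n) :
  measurable_fun setT (F \o row_of_tuple) -> measurable_row _ _ _ phi ->
  measurable_fun setT (F \o phi).
Proof.
move=> mF mphi.
pose psi t := [tuple phi t ord0 i | i < n].
have mpsi : measurable_fun setT psi.
  apply/measurable_fun_tnthP => i; have := mphi i; congr measurable_fun.
  by apply/funext => t /=; rewrite tnth_mktuple.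
have := measurableT_comp mF mpsi; congr measurable_fun.
apply/funext => t /=; congr F; apply/rowP => i.
by rewrite mxE tnth_mktuple.
Qed.

Lemma measurable_row_of_tuple d (T : measurableType d) n (f : T -> n.-tuple R) :
  measurable_fun setT f -> measurable_row _ _ _ (fun t => row_of_tuple (f t)).
Proof.
move=> mf i; have := (measurable_fun_tnthP _).1 mf i; congr measurable_fun.
by apply/funext => t /=; rewrite mxE.
Qed.

Lemma measurable_cons_row d (T : measurableType d) n (f : T -> R)
    (phi : T -> 'rV[R]_n) : measurable_fun setT f -> measurable_row _ _ _ phi ->
  measurable_row _ _ _ (fun t => cons_row n (f t) (phi t)).
Proof.
move=> mf mphi i; case: (unliftP ord0 i) => [j|] ->.
  by apply: (eq_measurable_fun (fun t => phi t ord0 j)) => // t _; rewrite cons_rowS.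
by apply: (eq_measurable_fun f) => // t _; rewrite cons_row0.
Qed.

Lemma measurable_rowD d (T : measurableType d) n (phi psi : T -> 'rV[R]_n) :
  measurable_row _ _ _ phi -> measurable_row _ _ _ psi ->
  measurable_row _ _ _ (fun t => phi t + psi t).
Proof.
move=> mphi mpsi i.
apply: (eq_measurable_fun (fun t => phi t ord0 i + psi t ord0 i)).
  by move=> t _; rewrite mxE.
exact: measurable_funD.
Qed.

Lemma measurable_row_mulmx d (T : measurableType d) n p (A : 'M[R]_(n, p))
    (phi : T -> 'rV[R]_n) : measurable_row _ _ _ phi ->
  measurable_row _ _ _ (fun t => phi t *m A).
Proof.
move=> mphi i.
apply: (eq_measurable_fun (fun t => \sum_k phi t ord0 k * A k i)).
  by move=> t _; rewrite mxE.
by apply: measurable_sum => k; apply: measurable_funM.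
Qed.

(** The parameter space [T] is arbitrary because the induction adds the first coordinate to it,
    replacing [T] by [T * R]. *)
Lemma measurable_row_integral (D : set R) n d (T : measurableType d)
    (F : T -> 'rV[R]_n -> \bar R) : measurable D ->
  (forall t v, 0 <= F t v)%E ->
  measurable_fun setT (fun p : T * n.-tuple R => F p.1 (row_of_tuple p.2)) ->
  measurable_fun setT (fun t => row_integral D n (F t)).
Proof.
move=> mD; elim: n d T F => [|n IH] d T F F0 mF /=.
  have := measurableT_comp mF (measurable_pair2 _ : measurable_fun setT
    (fun t : T => (t, [tuple] : 0.-tuple R))).
  congr measurable_fun; apply/funext => t /=.
  by rewrite [row_of_tuple _]thinmx0.
pose F' (p : T * R) v := F p.1 (cons_row n p.2 v).
have mF' : measurable_fun setT (fun p => row_integral D n (F' p)).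
  apply: IH => [p v|]; first exact: F0.
  have mg : measurable_fun setT (fun q : (T * R) * n.-tuple R =>
      (q.1.1, cons_tuple q.1.2 q.2)).
    apply: measurable_fun_pair; first exact: measurableT_comp.
    by apply: measurable_cons => //; exact: measurableT_comp.
  have := measurableT_comp mF mg; congr measurable_fun.
  by apply/funext => q /=; rewrite row_of_tuple_cons.
(* Extension by zero outside [D] turns the outer integral into one over the whole line, to which the
   measurability part of Tonelli's theorem applies. *)
pose Phi := (fun p => row_integral D n (F' p)) \_ (setT `*` D).
have mPhi : measurable_fun setT Phi.
  apply/(measurable_restrictT _ _).1; last exact: measurable_funTS.
  exact: measurableX.
have Phi0 p : (0 <= Phi p)%E.
  by apply: erestrict_ge0 => q _; apply: row_integral_ge0 => v; exact: F0.
have := @measurable_fun_fubini_tonelli_F _ _ _ _ _ mu Phi mPhi Phi0.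
congr measurable_fun; apply/funext => t; rewrite /fubini_F [RHS]integral_mkcond.
apply: eq_integral => x _; rewrite /Phi !patchE.
suff -> : ((t, x) \in setT `*` D) = (x \in D) by [].
by rewrite in_setX in_setT.
Qed.

End row_integral.

Section row_integral_theory.
Context {R : realType}.
Notation mu := (@lebesgue_measure R).
Local Notation borel F := (measurable_fun setT (F \o row_of_tuple)).

Lemma measurable_cons_row_comp n (F : 'rV[R]_n.+1 -> \bar R) (D : set R) :
  measurable D -> (forall v, 0 <= F v)%E -> borel F ->
  measurable_fun setT (fun x : R => row_integral D n (fun v => F (cons_row n x v))).
Proof.
move=> mD F0 mF; apply: measurable_row_integral => //.
apply: measurable_row_comp mF _; apply: measurable_cons_row => //.
exact: measurable_row_of_tuple.
Qed.

Lemma borel_cons_row n (F : 'rV[R]_n.+1 -> \bar R) x : borel F ->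
  borel (fun v => F (cons_row n x v)).
Proof.
move=> mF; apply: measurable_row_comp mF _; apply: measurable_cons_row => //.
exact: measurable_row_of_tuple.
Qed.

Definition box (D : set R) n : set 'rV[R]_n := [set v | forall i, D (v ord0 i)].

Lemma box_cons D n x (v : 'rV[R]_n) :
  box D n.+1 (cons_row n x v) <-> D x /\ box D n v.
Proof.
split=> [xv|[Dx Dv] i].
  by split=> [|i]; [have := xv ord0; rewrite cons_row0|
    have := xv (lift ord0 i); rewrite cons_rowS].
by case: (unliftP ord0 i) => [j|] ->; rewrite ?cons_rowS ?cons_row0.
Qed.

Definition geo_mean n (x y : 'rV[R]_n) : 'rV[R]_n :=
  \row_i Num.sqrt (x ord0 i * y ord0 i).

Lemma geo_mean_cons n x y (v w : 'rV[R]_n) :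
  geo_mean n.+1 (cons_row n x v) (cons_row n y w) =
  cons_row n (Num.sqrt (x * y)) (geo_mean n v w).
Proof.
apply/rowP => i; rewrite mxE.
by case: (unliftP ord0 i) => [j|] ->; rewrite ?cons_rowS ?cons_row0// mxE.
Qed.

(** Induction on [n]: for fixed first coordinates [x], [y], the induction hypothesis applied to the
    slices is exactly the hypothesis of the one-dimensional inequality for the integrals of the
    slices. *)
Theorem multiplicative_prekopa_leindler n (F G H : 'rV[R]_n -> \bar R) :
  borel F -> borel G -> borel H ->
  (forall v, 0 <= F v)%E -> (forall v, 0 <= G v)%E -> (forall v, 0 <= H v)%E ->
  (forall v w, box `]0%R, +oo[ n v -> box `]0%R, +oo[ n w ->
    (F v * G w <= H (geo_mean n v w) ^+ 2)%E) ->
  (row_integral `]0%R, +oo[ n F * row_integral `]0%R, +oo[ n G <=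
   row_integral `]0%R, +oo[ n H ^+ 2)%E.
Proof.
elim: n F G H => [|n IH] F G H mF mG mH F0 G0 H0 FGH /=.
  have := FGH 0 0; rewrite [geo_mean _ _ _]thinmx0; apply; by case.
apply: multiplicative_prekopa_leindler1; do ?exact: measurable_cons_row_comp.
- by move=> x; exact: row_integral_ge0.
- by move=> x; exact: row_integral_ge0.
- by move=> x; exact: row_integral_ge0.
move=> x y x0 y0; apply: IH => //; try exact: borel_cons_row.
move=> v w v0 w0; rewrite -geo_mean_cons.
by apply: FGH; apply/box_cons; split=> //=; rewrite in_itv/= andbT.
Qed.

Lemma row_integral_box D n (F : 'rV[R]_n -> \bar R) :
  row_integral D n F = row_integral setT n (F \_ (box D n)).
Proof.
elim: n F => [|n IH] F /=; first by rewrite patchE mem_set// => -[].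
rewrite integral_mkcond; apply: eq_integral => x _; rewrite patchE.
case: ifPn; rewrite ?notin_setE ?inE => Dx.
  rewrite IH; apply: eq_row_integral => v; rewrite !patchE.
  suff -> : (cons_row n x v \in box D n.+1) = (v \in box D n) by [].
  apply/idP/idP; rewrite !inE; first by move=> /box_cons[].
  by move=> Dv; exact/box_cons.
rewrite (eq_row_integral _ _ _ (fun=> 0%E)); last first.
  by move=> v; rewrite patchE memNset// => /box_cons[].
by elim: n {IH F} => //= n IHn; rewrite integral0_eq.
Qed.

Lemma row_integral_closed_orthant n (F : 'rV[R]_n -> \bar R) :
  (forall v, 0 <= F v)%E -> borel F ->
  row_integral `[0%R, +oo[ n F = row_integral `]0%R, +oo[ n F.
Proof.
elim: n F => [//|n IH] F F0 mF /=.
rewrite -integral_itv_obnd_cbnd; last first.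
  by apply: measurable_funTS; exact: measurable_cons_row_comp.
by apply: eq_integral => x _; apply: IH => //; exact: borel_cons_row.
Qed.

Lemma ge0_le_row_integral D n (F G : 'rV[R]_n -> \bar R) : measurable D ->
  (forall v, 0 <= F v)%E -> borel F -> borel G -> (forall v, F v <= G v)%E ->
  (row_integral D n F <= row_integral D n G)%E.
Proof.
move=> mD; elim: n F G => [|n IH] F G F0 mF mG FG /=; first exact: FG.
have G0 v : (0 <= G v)%E by exact: le_trans (FG v).
apply: ge0_le_integral => //.
- by move=> x _; exact: row_integral_ge0.
- by apply: measurable_funTS; exact: measurable_cons_row_comp.
- by apply: measurable_funTS; exact: measurable_cons_row_comp.
- by move=> x _; apply: IH => //; exact: borel_cons_row.
Qed.

Lemma ge0_row_integralD D n (F G : 'rV[R]_n -> \bar R) : measurable D ->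
  (forall v, 0 <= F v)%E -> (forall v, 0 <= G v)%E -> borel F -> borel G ->
  row_integral D n (fun v => F v + G v)%E =
  (row_integral D n F + row_integral D n G)%E.
Proof.
move=> mD; elim: n F G => [//|n IH] F G F0 G0 mF mG /=.
rewrite -ge0_integralD//.
- by apply: eq_integral => x _; apply: IH => //; exact: borel_cons_row.
- by move=> x _; exact: row_integral_ge0.
- by apply: measurable_funTS; exact: measurable_cons_row_comp.
- by move=> x _; exact: row_integral_ge0.
- by apply: measurable_funTS; exact: measurable_cons_row_comp.
Qed.

Lemma ge0_integral_even (phi : R -> \bar R) : measurable_fun setT phi ->
  (forall x, 0 <= phi x)%E -> (forall x, phi (- x) = phi x) ->
  (\int[mu]_x phi x = 2%:E * \int[mu]_(x in `]0%R, +oo[) phi x)%E.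
Proof.
move=> mphi phi0 ephi.
rewrite -(setUv `]0%R, +oo[%classic) ge0_integral_setU//=; last 3 first.
- exact: measurableC.
- by rewrite setUv.
- by apply/disj_setPCl.
rewrite setCitvr -integral_itv_bndo_bndc; last exact: measurable_funTS.
suff -> : (\int[mu]_(x in `]-oo, 0%R[) phi x = \int[mu]_(x in `]0%R, +oo[) phi x)%E.
  by rewrite -mule2n -mule_natl.
rewrite [RHS]integral_mkcond.
have n1 : (-1 : R) != 0 by rewrite oppr_eq0.
have := ge0_integral_affine (-1) 0 (phi \_ `]0%R, +oo[%classic) n1.
rewrite normrN1 invr1 mul1e => <-; last 2 first.
- by apply/(measurable_restrictT _ _).1 => //; exact: measurable_funTS.
- by move=> x; exact: erestrict_ge0.
rewrite integral_mkcond; apply: eq_integral => x _.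
rewrite !patchE addr0 mulN1r ephi.
suff -> : (x \in `]-oo, 0%R[%classic) = (- x \in `]0%R, +oo[%classic) by [].
by rewrite !mem_setE !in_itv/= andbT oppr_gt0.
Qed.

(** One coordinate is folded at a time. Dependence on the absolute values of the coordinates is a
    hypothesis that slices inherit. *)
Lemma row_integral_even n (F : 'rV[R]_n -> \bar R) : borel F ->
  (forall v, 0 <= F v)%E ->
  (forall v w : 'rV[R]_n, (forall i, `|v ord0 i| = `|w ord0 i|) -> F v = F w) ->
  (row_integral setT n F = (2 ^+ n)%:E * row_integral `]0%R, +oo[ n F)%E.
Proof.
elim: n F => [|n IH] F mF F0 eF /=; first by rewrite expr0 mul1e.
rewrite ge0_integral_even//; last 3 first.
- exact: measurable_cons_row_comp.
- by move=> x; exact: row_integral_ge0.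
- move=> x; apply: eq_row_integral => v; apply: eF => i.
  by case: (unliftP ord0 i) => [j|] ->; rewrite ?cons_rowS// !cons_row0 normrN.
rewrite exprS EFinM -muleA; congr (_ * _)%E.
rewrite -ge0_integralZl//; last 2 first.
- by apply: measurable_funTS; exact: measurable_cons_row_comp.
- by move=> x _; exact: row_integral_ge0.
apply: eq_integral => x _; apply: IH => // [|v w vw].
  exact: borel_cons_row.
apply: eF => i.
by case: (unliftP ord0 i) => [j|] ->; rewrite ?cons_rowS// !cons_row0.
Qed.

Lemma row_integral_translation n (F : 'rV[R]_n -> \bar R) (b : 'rV[R]_n) :
  borel F -> (forall v, 0 <= F v)%E ->
  row_integral setT n (fun v => F (b + v)) = row_integral setT n F.
Proof.
elim: n F b => [|n IH] F b mF F0 /=; first by rewrite [b + 0]thinmx0.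
pose b' : 'rV[R]_n := \row_i b ord0 (lift ord0 i).
have bE x v : b + cons_row n x v = cons_row n (1 * x + b ord0 ord0) (b' + v).
  apply/rowP => i; rewrite mxE.
  case: (unliftP ord0 i) => [j|] ->; first by rewrite !cons_rowS !mxE.
  by rewrite !cons_row0 mul1r addrC.
pose phi x := row_integral setT n (fun v => F (cons_row n x v)).
transitivity (\int[mu]_x phi (1 * x + b ord0 ord0)%R)%E.
  apply: eq_integral => x _; rewrite /phi.
  rewrite -[RHS](IH _ b'); [|exact: borel_cons_row|by []].
  by apply: eq_row_integral => v; rewrite bE.
rewrite (ge0_integral_affine _ _ phi) ?oner_eq0//; last 2 first.
- exact: measurable_cons_row_comp.
- by move=> x; exact: row_integral_ge0.
by rewrite normr1 invr1 mul1e.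
Qed.

(** Makes the first coordinate the innermost variable, as needed for a shear that moves it by a
    function of the others. *)
Lemma row_integral_fubini n (Phi : R -> 'rV[R]_n -> \bar R) :
  (forall x v, 0 <= Phi x v)%E ->
  measurable_fun setT (fun p : R * n.-tuple R => Phi p.1 (row_of_tuple p.2)) ->
  (\int[mu]_x row_integral setT n (Phi x) =
   row_integral setT n (fun v => \int[mu]_x Phi x v))%E.
Proof.
elim: n Phi => [//|n IH] Phi Phi0 mPhi /=.
have mPhi2 d (T : measurableType d) (f g : T -> R) (phi : T -> 'rV[R]_n) :
    measurable_fun setT f -> measurable_fun setT g -> measurable_row _ _ _ phi ->
    measurable_fun setT (fun t => Phi (f t) (cons_row n (g t) (phi t))).
  move=> mf mg mphi.
  have mh : measurable_fun setT (fun t => (f t, cons_tuple (g t)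
      [tuple phi t ord0 i | i < n])).
    apply: measurable_fun_pair => //; apply: measurable_cons => //.
    apply/measurable_fun_tnthP => i; apply: (eq_measurable_fun (fun t => phi t ord0 i)) => //.
    by move=> t _ /=; rewrite tnth_mktuple.
  apply: (eq_measurable_fun _ _ (measurableT_comp mPhi mh)) => t _ /=.
  rewrite row_of_tuple_cons; congr (Phi _ (cons_row _ _ _)).
  by apply/rowP => i; rewrite mxE tnth_mktuple.
pose Psi (p : R * R) := row_integral setT n (fun v => Phi p.1 (cons_row n p.2 v)).
have mPsi : measurable_fun setT Psi.
  apply: measurable_row_integral => //.
  apply: mPhi2; do ?exact: measurableT_comp.
  exact: measurable_row_of_tuple.
have Psi0 p : (0 <= Psi p)%E by apply: row_integral_ge0 => v; exact: Phi0.
rewrite (@fubini_tonelli _ _ _ _ _ mu mu Psi mPsi Psi0).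
apply: eq_integral => y _; rewrite -IH//.
apply: mPhi2 => //.
exact: measurable_row_of_tuple.
Qed.

End row_integral_theory.

(** * Linear changes of variables *)

Section linear_change_of_variables.
Context {R : realType}.
Notation mu := (@lebesgue_measure R).
Local Notation borel F := (measurable_fun setT (F \o row_of_tuple)).

Lemma borel_mulmx n (A : 'M[R]_n) (F : 'rV[R]_n -> \bar R) : borel F ->
  borel (fun v => F (v *m A)).
Proof.
move=> mF; apply: measurable_row_comp mF _; apply: measurable_row_mulmx.
exact: measurable_row_of_tuple.
Qed.

(** The linear change of variables formula as a property of the matrix: it is stable under products,
    hence need only be checked on the factors of an elimination. *)
Definition scales_integral n (A : 'M[R]_n) := forall F : 'rV[R]_n -> \bar R,
  borel F -> (forall v, 0 <= F v)%E ->
  row_integral setT n (fun v => F (v *m A)) =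
  (`|\det A|^-1%:E * row_integral setT n F)%E.

Lemma scales_integralM n (A B : 'M[R]_n) :
  scales_integral n A -> scales_integral n B -> scales_integral n (A *m B).
Proof.
move=> sA sB F mF F0.
rewrite (eq_row_integral _ _ _ (fun v => F (v *m A *m B))); last first.
  by move=> v; rewrite mulmxA.
rewrite (sA (fun v => F (v *m B)))//; last exact: borel_mulmx.
by rewrite sB// muleA -EFinM det_mulmx normrM invfM.
Qed.

Lemma cons_row_block n x (v : 'rV[R]_n) (A : 'M[R]_1) (u : 'rV[R]_n)
    (l : 'cV[R]_n) (S : 'M[R]_n) :
  cons_row n x v *m (block_mx A u l S : 'M[R]_n.+1) =
  cons_row n (x * A ord0 ord0 + (v *m l) ord0 ord0) (x *: u + v *m S).
Proof.
apply: etrans (mul_row_block (x%:M : 'M[R]_1) v A u l S) _.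
rewrite !mul_scalar_mx /cons_row; congr row_mx.
apply/rowP => i; rewrite !ord1 !mxE eqxx mulr1n; congr (_ + _).
Qed.

(** For a fixed first coordinate [x], this shear translates the remaining coordinates by
    [x *: u]. *)
Lemma scales_integral_upper n (u : 'rV[R]_n) :
  scales_integral n.+1 (block_mx 1%:M u 0 1%:M).
Proof.
move=> F mF F0 /=; rewrite (det_ublock (n1 := 1)) !det1 mulr1 normr1 invr1 mul1e.
apply: eq_integral => x _.
rewrite -[RHS](row_integral_translation _ _ (x *: u)) => [|//|//].
  apply: eq_row_integral => v.
  by rewrite cons_row_block mulmx0 mulmx1 !mxE eqxx mulr1n mulr1 addr0.
exact: borel_cons_row.
Qed.

Lemma scales_integral_diag n (a : R) (S : 'M[R]_n) : a != 0 ->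
  scales_integral n S -> scales_integral n.+1 (block_mx (a%:M : 'M[R]_1) 0 0 S).
Proof.
move=> a0 sS F mF F0 /=; rewrite (det_ublock (n1 := 1)) det_scalar1.
pose phi x := row_integral setT n (fun v => F (cons_row n x v)).
transitivity (\int[mu]_x (`|\det S|^-1%:E * phi (a * x + 0)%R))%E.
  apply: eq_integral => x _; rewrite /phi -sS//; last exact: borel_cons_row.
  apply: eq_row_integral => v.
  by rewrite cons_row_block scaler0 mulmx0 !mxE eqxx mulr1n !addr0 add0r mulrC.
have mphi : measurable_fun setT phi by exact: measurable_cons_row_comp.
have phi0 x : (0 <= phi x)%E by exact: row_integral_ge0.
rewrite ge0_integralZl//; last first.
  have maff : measurable_fun setT (fun x : R => a * x + 0).
    by apply: measurable_funD => //; exact: mulrl_measurable.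
  exact: (measurableT_comp mphi maff).
by rewrite ge0_integral_affine// muleA -EFinM normrM invfM mulrC.
Qed.

(** Here the first coordinate is translated by an amount depending on the others, so it is
    integrated first, after two uses of Fubini. *)
Lemma scales_integral_lower n (l : 'cV[R]_n) :
  scales_integral n.+1 (block_mx 1%:M 0 l 1%:M).
Proof.
move=> F mF F0 /=; rewrite (det_lblock (n1 := 1)) !det1 mulr1 normr1 invr1 mul1e.
rewrite row_integral_fubini//; last first.
  apply: measurable_row_comp mF _; apply: measurable_row_mulmx.
  by apply: measurable_cons_row => //; exact: measurable_row_of_tuple.
rewrite row_integral_fubini//; last first.
  apply: measurable_row_comp mF _.
  by apply: measurable_cons_row => //; exact: measurable_row_of_tuple.
apply: eq_row_integral => v.
pose phi x := F (cons_row n x v).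
transitivity (\int[mu]_x phi (1 * x + (v *m l) ord0 ord0)%R)%E.
  apply: eq_integral => x _; rewrite cons_row_block scaler0 add0r mulmx1.
  by rewrite !mxE eqxx mulr1 mul1r.
rewrite (ge0_integral_affine _ _ phi) ?oner_eq0//; last 2 first.
- apply: measurable_row_comp mF _; apply: measurable_cons_row.
    exact: measurable_id.
  by move=> i; exact: measurable_cst.
- by move=> x; exact: F0.
by rewrite normr1 invr1 mul1e.
Qed.

(* Gaussian elimination on the top left coefficient; when it vanishes, it is
   first made nonzero by adding to the first row another row. *)
Theorem scales_integral_unitmx n (A : 'M[R]_n) : A \in unitmx ->
  scales_integral n A.
Proof.
elim: n A => [|n IH] A uA.
  move=> F mF F0 /=; rewrite det_mx00 normr1 invr1 mul1e.
  by rewrite [_ *m _]thinmx0 .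
have corner (B : 'M[R]_(1 + n)) : B \in unitmx -> B ord0 ord0 != 0 ->
    scales_integral n.+1 B.
  move=> uB B0; set a := B ord0 ord0 in B0.
  pose u := ursubmx B; pose l := dlsubmx B.
  (* [S] is the Schur complement of the pivot [a]; since the determinant of [B] is [a] times that of
     [S], it is invertible and the induction hypothesis applies to it. *)
  pose S := drsubmx B - a^-1 *: (l *m u).
  have BE : B = block_mx 1%:M 0 (a^-1 *: l) 1%:M *m
      (block_mx (a%:M : 'M[R]_1) 0 0 S *m block_mx 1%:M (a^-1 *: u) 0 1%:M).
    rewrite !mulmx_block !(mulmx0, mul0mx, mulmx1, mul1mx, addr0, add0r).
    rewrite -!scalemxAl -!scalemxAr scalerA !mul_scalar_mx !mul_mx_scalar.
    rewrite -scalemxAr !scalerA -mulrA !mulVf// mulr1 !scale1r.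
    rewrite /S [_ + (_ - _)]addrC subrK -[LHS]submxK; congr block_mx.
    by apply/matrixP => i j; rewrite !ord1 !mxE eqxx mulr1n /a; congr (B _ _); exact/val_inj.
  have uS : S \in unitmx.
    move: uB; rewrite !unitmxE BE !det_mulmx det_lblock det_ublock det_ublock.
    rewrite !det1 det_scalar1 !mulr1 mul1r !unitfE mulf_eq0 negb_or.
    by move=> /andP[].
  rewrite BE; apply: scales_integralM; first exact: scales_integral_lower.
  apply: scales_integralM; last exact: scales_integral_upper.
  by apply: scales_integral_diag => //; exact: IH.
have [A0|A0] := eqVneq (A ord0 ord0) 0; last exact: corner.
have [i Ai] : exists i : 'I_n, A (lift ord0 i) ord0 != 0.
  apply/existsP; apply: contraT; rewrite negb_exists => /forallP A_eq0.
  move: uA; rewrite unitmxE unitfE (expand_det_col _ ord0) big1 ?eqxx// => i _.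
  case: (unliftP ord0 i) => [j|] ->; rewrite ?A0 ?mul0r//.
  by move/eqP: (negbNE (A_eq0 j)) => ->; rewrite mul0r.
(* Left multiplication by [E s] adds [s] times row [lift ord0 i] to the first row; [E (-1)] undoes
   [E 1]. *)
pose E (s : R) : 'M[R]_n.+1 := block_mx 1%:M (s *: delta_mx (0 : 'I_1) i : 'rV[R]_n) 0 1%:M.
have AE : A = E (-1) *m (E 1 *m A).
  rewrite mulmxA (_ : E (-1) *m E 1 = 1%:M) ?mul1mx//.
  rewrite /E (mulmx_block (m1 := 1) (n1 := 1) (p1 := 1)).
  rewrite !(mulmx0, mul0mx, mulmx1, mul1mx, addr0, add0r).
  by rewrite -scalerDl subrr scale0r -scalar_mx_block.
have uE s : E s \in unitmx.
  by rewrite unitmxE (det_ublock (n1 := 1)) !det1 mulr1 unitr1.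
rewrite AE; apply: scales_integralM; first exact: scales_integral_upper.
apply: corner; first by rewrite unitmx_mul uE.
rewrite mxE big_ord_recl A0 mulr0 add0r (bigD1 i)//= big1 => [|j ji].
  rewrite addr0 (_ : lift ord0 i = rshift 1 i); last exact/val_inj.
  rewrite (_ : ord0 = lshift n (ord0 : 'I_1)); last exact/val_inj.
  rewrite /E (block_mxEur (m1 := 1) (n1 := 1)) scale1r !mxE !eqxx mul1r.
  by move: Ai; congr (A _ _ != 0); exact/val_inj.
rewrite (_ : lift ord0 j = rshift 1 j); last exact/val_inj.
rewrite [in X in X * _](_ : ord0 = lshift n (ord0 : 'I_1)); last exact/val_inj.
by rewrite /E (block_mxEur (m1 := 1) (n1 := 1)) scale1r !mxE (negbTE ji) andbF mul0r.
Qed.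

End linear_change_of_variables.

(** * Yao-Yao partitions *)

Section yao_yao_cones.
Context {R : realType}.

(** The number [k] of generators is separate from the ambient dimension [n], since the recursion
    passes through subspaces of smaller dimension. *)
Definition simplicial_cone k n (c : 'rV[R]_n) (T : 'M[R]_(k, n)) : set 'rV[R]_n :=
  [set c + l *m T | l in [set l : 'rV[R]_k | forall i, 0 <= l ord0 i]].

Lemma cone_pos_simplicial k n (c v : 'rV[R]_n) (T : 'M[R]_(k, n)) :
  cone_pos (simplicial_cone k n c T) v =
  simplicial_cone k.+1 n c (col_mx v T : 'M[R]_(1 + k, n)).
Proof.
apply/seteqP; split=> x.
  move=> [_ [l l0 <-] [t /= t0 <-]]; exists (row_mx (t%:M : 'M[R]_1) l) => [i /=|].
    case: (@split_ordP 1 k i) => j ->; last by rewrite (row_mxEr (n1 := 1)).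
    by rewrite (row_mxEl (n1 := 1)) mxE !ord1 eqxx mulr1n.
  rewrite -addrA; congr (_ + _).
  by rewrite (mul_row_col (n1 := 1)) mul_scalar_mx addrC.
move=> [l l0 <-].
exists (c + rsubmx (l : 'rV[R]_(1 + k)) *m T).
  by exists (rsubmx (l : 'rV[R]_(1 + k))) => // i; rewrite mxE; exact: l0.
exists (l ord0 ord0); first exact: l0.
rewrite -addrA; congr (_ + _).
rewrite -[in RHS](@hsubmxK R 1 1 k l) (mul_row_col (n1 := 1)) addrC; congr (_ + _).
rewrite [lsubmx _]mx11_scalar mul_scalar_mx mxE; congr (l _ _ *: _); exact/val_inj.
Qed.

Lemma cone_neg_pos n (A : set 'rV[R]_n) (v : 'rV[R]_n) :
  cone_neg A v = cone_pos A (- v).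
Proof.
by apply/seteqP; split=> x [u Au [t /= t0 <-]]; exists u => //; exists (- t);
  rewrite /= ?oppr_ge0 ?oppr_le0// scalerN scaleNr ?opprK.
Qed.

(** The rows of [T] stay inside [W] while [v] does not, so adding [v] strictly enlarges the row
    space. *)
Lemma col_mx_free k n (v : 'rV[R]_n) (W V : 'M[R]_n) (T : 'M[R]_(k, n)) :
  (T <= W)%MS -> (W <= V)%MS -> (v <= V)%MS -> ~~ (v <= W)%MS -> \rank T = k ->
  ((col_mx v T : 'M[R]_(1 + k, n)) <= V)%MS /\
  \rank (col_mx v T : 'M[R]_(1 + k, n)) = k.+1.
Proof.
move=> TW WV vV vW rT; split.
  by rewrite col_mx_sub vV (submx_trans TW).
apply/eqP; rewrite eqn_leq rank_leq_row/= -{1}rT.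
apply: rank_ltmx; rewrite ltmxE -{1}addsmxE addsmxSr/= col_mx_sub submx_refl andbT.
by apply: contra vW => /submx_trans; apply.
Qed.

(* The cones are indexed by a list because the pieces of the partition may
   coincide as sets; the last clause is the half-space property of the center. *)
Lemma yao_yao_cones n (a : 'rV[R]_n) (V : 'M[R]_n) P c : yao_yao a V P c ->
  forall k, \rank V = k ->
  exists s : seq 'M[R]_(k, n), [/\ size s = (2 ^ k)%N,
    forall T, T \in s -> [/\ P (simplicial_cone k n c T), (T <= V)%MS & \rank T = k] &
    forall y : 'rV[R]_n, exists2 T, T \in s & forall i, 0 <= (T *m y^T) i ord0].
Proof.
elim=> {a V P c} [a V rV k|a V b W v Pm Pp c rV _ WV rW vV vW _ IHm _ IHp k rk].
  rewrite rV => <-; exists [:: 0]; split=> // [T|y].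
    rewrite inE => /eqP ->; split; rewrite ?sub0mx ?mxrank0//.
    apply/seteqP; split=> x /=; first by move=> [l _ <-]; rewrite mulmx0 addr0.
    by move=> ->; exists 0; rewrite ?mulmx0 ?addr0// => -[].
  by exists 0; rewrite ?inE// => -[].
case: k rk rV => [->//|k] rk _; move: rW; rewrite rk /= => rW.
have [sm [size_m Pm_s ym]] := IHm _ rW; have [sp [size_p Pp_s yp]] := IHp _ rW.
pose ext (u : 'rV[R]_n) (T : 'M[R]_(k, n)) : 'M[R]_(k.+1, n) := col_mx u T.
have extE u T (y : 'rV[R]_n) i : (ext u T *m y^T) i ord0 =
    if unlift ord0 i is Some j then (T *m y^T) j ord0 else (u *m y^T) ord0 ord0.
  rewrite /ext (mul_col_mx (m1 := 1)); case: unliftP => [j|] ->.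
    by rewrite (_ : lift ord0 j = rshift 1 j) ?(col_mxEd (m1 := 1))//; exact/val_inj.
  by rewrite (_ : ord0 = lshift k (ord0 : 'I_1)) ?(col_mxEu (m1 := 1))//; exact/val_inj.
have NvV : (- v <= V)%MS by rewrite (eqmx_opp v).
have NvW : ~~ (- v <= W)%MS by rewrite (eqmx_opp v).
exists ([seq ext (- v) T | T <- sm] ++ [seq ext v T | T <- sp]); split.
- by rewrite size_cat !size_map size_m size_p expnS mul2n addnn.
- move=> T; rewrite mem_cat => /orP[] /mapP[U Us ->].
    have [PU UW rU] := Pm_s _ Us; have [? ?] := col_mx_free _ _ _ _ _ _ UW WV NvV NvW rU.
    split=> //; left; exists (simplicial_cone k n c U) => //.
    by rewrite cone_neg_pos cone_pos_simplicial.
  have [PU UW rU] := Pp_s _ Us; have [? ?] := col_mx_free _ _ _ _ _ _ UW WV vV vW rU.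
  split=> //; right; exists (simplicial_cone k n c U) => //.
  by rewrite cone_pos_simplicial.
(* The sign of the scalar product of [v] and [y] selects the side of the hyperplane, and the
   induction hypothesis selects the cone on that side. *)
- move=> y; have [vy|vy] := leP 0 ((v *m y^T) ord0 ord0).
    have [T Ts Ty] := yp y; exists (ext v T) => [|i].
      by rewrite mem_cat map_f ?orbT.
    by rewrite extE; case: (unlift _ _).
  have [T Ts Ty] := ym y; exists (ext (- v) T) => [|i].
    by rewrite mem_cat map_f.
  rewrite extE; case: (unlift _ _) => //.
  by rewrite mulNmx mxE oppr_ge0 ltW.
Qed.

End yao_yao_cones.

(** * Integrals over linear images of the orthant *)

Section cone_integrals.
Context {R : realType}.
Local Notation borel F := (measurable_fun setT (F \o row_of_tuple)).

Lemma measurable_box d (T : measurableType d) (D : set R) n (phi : T -> 'rV[R]_n) :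
  measurable D -> measurable_row _ _ _ phi -> measurable [set t | box D n (phi t)].
Proof.
move=> mD mphi.
rewrite (_ : [set t | _] = \bigcap_(i in [set: 'I_n]) ((fun t => phi t ord0 i) @^-1` D)).
  apply: fin_bigcap_measurable => // i _.
  by rewrite -[X in measurable X]setTI; exact: mphi.
by apply/seteqP; split=> [t Dt i _|t Dt i]; [exact: Dt | exact: Dt].
Qed.

Lemma borel_patch n (F : 'rV[R]_n -> \bar R) (S : set 'rV[R]_n) : borel F ->
  measurable [set t : n.-tuple R | S (row_of_tuple t)] -> borel (F \_ S).
Proof.
move=> mF mS; rewrite (_ : _ \o _ = (F \o row_of_tuple) \_ [set t | S (row_of_tuple t)]).
  exact: (measurable_restrictT (F \o row_of_tuple) mS).1 (measurable_funTS mF).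
by apply/funext => t; rewrite /= !patchE.
Qed.

(** For invertible [M], the image of the closed orthant under [v -> v *m M], written through the
    inverse so that it is visibly Borel. *)
Definition image_orthant n (M : 'M[R]_n) : set 'rV[R]_n :=
  [set v | box `[0%R, +oo[ n (v *m invmx M)].

Lemma borel_patch_image_orthant n (M : 'M[R]_n) (F : 'rV[R]_n -> \bar R) :
  borel F -> borel (F \_ (image_orthant n M)).
Proof.
move=> mF; apply: borel_patch => //; apply: measurable_box => //.
by apply: measurable_row_mulmx; exact: measurable_row_of_tuple.
Qed.

Lemma row_integral_image_orthant n (M : 'M[R]_n) (F : 'rV[R]_n -> \bar R) :
  M \in unitmx -> borel F -> (forall v, 0 <= F v)%E ->
  row_integral setT n (F \_ (image_orthant n M)) =
  (`|\det M|%:E * row_integral `]0%R, +oo[ n (fun v => F (v *m M)))%E.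
Proof.
move=> uM mF F0; rewrite -row_integral_closed_orthant//; last exact: borel_mulmx.
rewrite [in RHS]row_integral_box.
rewrite [in RHS](eq_row_integral _ _ _ (fun v => (F \_ (image_orthant n M)) (v *m M))).
  rewrite (scales_integral_unitmx _ _ uM (F \_ (image_orthant n M))); last 2 first.
  - exact: borel_patch_image_orthant.
  - by move=> v; exact: erestrict_ge0.
  by rewrite muleA -EFinM divff ?mul1e// normr_eq0 -unitfE -unitmxE.
move=> v; rewrite !patchE; suff -> : (v \in box `[0%R, +oo[ n) =
  (v *m M \in image_orthant n M) by [].
by apply/idP/idP; rewrite !inE /image_orthant /= mulmxK.
Qed.

Lemma borel_sum (I : Type) (s : seq I) n (F : I -> 'rV[R]_n -> \bar R) :
  (forall i, borel (F i)) -> borel (fun v => \sum_(i <- s) F i v)%E.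
Proof.
move=> mF; elim: s => [|i s IH].
  by apply: (eq_measurable_fun (cst 0%E)) => // t _ /=; rewrite big_nil.
apply: (eq_measurable_fun ((F i \o row_of_tuple) \+
    ((fun v => \sum_(i <- s) F i v) \o row_of_tuple))%E).
  by move=> t _ /=; rewrite big_cons.
exact: emeasurable_funD.
Qed.

Lemma ge0_row_integral_sum (I : Type) (s : seq I) n (F : I -> 'rV[R]_n -> \bar R) :
  (forall i v, 0 <= F i v)%E -> (forall i, borel (F i)) ->
  row_integral setT n (fun v => \sum_(i <- s) F i v)%E =
  (\sum_(i <- s) row_integral setT n (F i))%E.
Proof.
move=> F0 mF; elim: s => [|i s IH].
  rewrite big_nil (eq_row_integral _ _ _ (fun=> 0%E)) => [|v]; last by rewrite big_nil.
  by elim: n {F F0 mF} => //= n IHn; rewrite integral0_eq.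
rewrite big_cons -IH -ge0_row_integralD//.
- by apply: eq_row_integral => v; rewrite big_cons.
- by move=> v; apply: sume_ge0 => j _; exact: F0.
- exact: borel_sum.
Qed.

Lemma dotp_mulmx n (x y : 'rV[R]_n) : dotp x y = (x *m y^T) ord0 ord0.
Proof. by rewrite mxE; apply: eq_bigr => i _; rewrite mxE. Qed.

(** Ties the coordinatewise means of Prekopa-Leindler to the argument [sqrt(x . y)] of the
    weight. *)
Lemma enorm_geo_mean n (v w : 'rV[R]_n) : (forall i, 0 <= v ord0 i * w ord0 i) ->
  enorm (geo_mean n v w) = Num.sqrt (dotp v w).
Proof.
move=> vw; rewrite /enorm; congr Num.sqrt; apply: eq_bigr => i _.
by rewrite !mxE -expr2 sqr_sqrtr.
Qed.

Lemma borel_enorm_comp n (rho : R -> R) :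
  measurable_fun (`[0%R, +oo[%classic : set R) rho ->
  borel (fun x : 'rV[R]_n => (rho (enorm x))%:E).
Proof.
move=> mrho.
(* The weight is known to be measurable only on the half-line, hence the extension by zero; norms
   are nonnegative, so the composite is unchanged. *)
have mrho' : measurable_fun setT (rho \_ `[0%R, +oo[%classic).
  by apply/(measurable_restrictT _ _).1.
apply: (eq_measurable_fun (EFin \o (rho \_ `[0%R, +oo[%classic) \o
    (@enorm R n \o row_of_tuple))).
  by move=> t _ /=; rewrite patchE mem_set//= in_itv/= andbT sqrtr_ge0.
apply: measurableT_comp; first exact: measurableT_comp.
have msqrt : measurable_fun setT (Num.sqrt : R -> R).
  by apply: continuous_measurable_fun => x; exact: sqrt_continuous.
have mdotp : measurable_fun setT
    (fun t : n.-tuple R => dotp (row_of_tuple t) (row_of_tuple t)).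
  apply: measurable_sum => i.
  by apply: measurable_funM; exact: measurable_row_of_tuple.
exact: (measurableT_comp msqrt mdotp).
Qed.

End cone_integrals.

(** * Summation over the pieces of the equipartition *)

Theorem mainTheorem3 (R : realType) (n : nat) (f : 'rV[R]_n -> R) (c : 'rV[R]_n) :
  (forall x, 0 <= f x) -> borel_fun f ->
  (Rn_integral (fun x => (f x)%:E) < +oo)%E ->
  yao_yao_center (density_measure f) c ->
  forall (rho : R -> R) (g : 'rV[R]_n -> R),
    weight rho ->
    (forall y, 0 <= g y) -> borel_fun g ->
    (forall x y : 'rV[R]_n, 0 <= dotp x y ->
       f (c + x) * g y <= (rho (Num.sqrt (dotp x y))) ^+ 2) ->
    (Rn_integral (fun x => (f x)%:E) * Rn_integral (fun y => (g y)%:E) <=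
     (Rn_integral (fun x : 'rV[R]_n => (rho (enorm x))%:E)) ^+ 2)%E.
Proof.
move=> f0 mf f_fin [P [YP eqP]] rho g [mrho [rho0 _]] g0 mg fg.
have [s [size_s cone_s cover_s]] := yao_yao_cones _ _ _ _ _ YP _ (mxrank1 _ _).
have us T : T \in s -> T \in unitmx.
  by move=> /cone_s[_ _ rT]; rewrite -row_free_unit /row_free rT.
pose F x := (f (c + x))%:E; pose G y := (g y)%:E.
pose H (x : 'rV[R]_n) := (rho (enorm x))%:E.
have F0 x : (0 <= F x)%E by rewrite lee_fin.
have G0 x : (0 <= G x)%E by rewrite lee_fin.
have H0 x : (0 <= H x)%E by rewrite lee_fin rho0// sqrtr_ge0.
have mf' : measurable_fun setT ((fun x => (f x)%:E) \o row_of_tuple).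
  exact/measurable_EFinP.
have mF : measurable_fun setT (F \o row_of_tuple).
  have mc : measurable_row _ _ _ (fun t : n.-tuple R => c + row_of_tuple t).
    apply: measurable_rowD; first by move=> i; exact: measurable_cst.
    exact: measurable_row_of_tuple.
  exact: (measurable_row_comp _ _ _ _ _ _ _ mf' mc).
have mG : measurable_fun setT (G \o row_of_tuple) by exact/measurable_EFinP.
have mH : measurable_fun setT (H \o row_of_tuple) by exact: borel_enorm_comp.
pose K := row_integral `]0%R, +oo[ n H.
have K0 : (0 <= K)%E by exact: row_integral_ge0.
have fE : Rn_integral (fun x => (f x)%:E) = row_integral setT n F.
  by rewrite Rn_integralE -(row_integral_translation n _ c mf')// => v; rewrite lee_fin.
have HE : Rn_integral H = ((2 ^+ n)%:E * K)%E.
  rewrite Rn_integralE row_integral_even// => v w vw.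
  rewrite /H /enorm /dotp; congr (rho (Num.sqrt _))%:E; apply: eq_bigr => i _.
  by rewrite -!expr2 -real_normK ?num_real// vw real_normK ?num_real.
(* The equipartition hypothesis, after a translation taking the center [c] to the origin. *)
have pieceF T : T \in s -> row_integral setT n (F \_ (image_orthant n T)) =
    ((2 ^- n)%:E * Rn_integral (fun x => (f x)%:E))%E.
  move=> Ts; have [PT _ _] := cone_s _ Ts; move: (eqP _ PT).
  have -> : density_measure f setT = Rn_integral (fun x => (f x)%:E).
    by congr Rn_integral; apply/funext => x; rewrite indicT mulr1.
  move=> <-; rewrite /density_measure Rn_integralE.
  rewrite -(row_integral_translation _ _ (- c)); last 2 first.
  - exact: borel_patch_image_orthant.
  - by move=> v; exact: erestrict_ge0.
  apply: eq_row_integral => x; rewrite patchE indicE.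
  have -> : (x \in simplicial_cone n n c T) = (- c + x \in image_orthant n T).
    apply/idP/idP; rewrite !inE /image_orthant /=.
      move=> [l l0 <-]; rewrite addKr (mulmxK (us _ Ts)) => i /=.
      by rewrite in_itv/= andbT.
    move=> cx; exists ((- c + x) *m invmx T) => [i|].
      by have := cx i; rewrite /= in_itv/= andbT.
    by rewrite mulmxKV ?us// addNKr.
  by rewrite /F addNKr; case: ifPn; rewrite ?mulr1 ?mulr0.
(* The inverse transpose sends the orthant to the dual cone of the piece: the vectors having
   nonnegative scalar product with every row of [T]. *)
pose M (T : 'M[R]_n) : 'M[R]_n := (invmx T)^T.
have uM T : T \in s -> M T \in unitmx.
  by move=> Ts; rewrite unitmx_tr unitmx_inv us.
(* The dual cones cover the space; overlaps only increase the sum because [G] is nonnegative. *)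
have coverG y : (G y <= \sum_(T <- s) (G \_ (image_orthant n (M T))) y)%E.
  have [T Ts Ty] := cover_s y.
  rewrite (big_rem T)//= patchE mem_set; last first.
    move=> i /=; rewrite /M -trmx_inv invmxK in_itv/= andbT.
    by rewrite -[X in X *m _]trmxK -trmx_mul mxE.
  by rewrite leeDl// sume_ge0// => T' _; exact: erestrict_ge0.
have orthant_le T : T \in s ->
    (row_integral setT n (F \_ (image_orthant n T)) *
     row_integral setT n (G \_ (image_orthant n (M T))) <= K ^+ 2)%E.
  move=> Ts; rewrite (row_integral_image_orthant _ _ _ (us _ Ts) mF F0).
  rewrite (row_integral_image_orthant _ _ _ (uM _ Ts) mG G0).
  (* The determinants of [T] and of its inverse transpose cancel. *)
  rewrite muleACA -EFinM /M det_tr det_inv normrV ?unitfE; last first.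
    by rewrite -unitfE -unitmxE us.
  rewrite divff ?mul1e; last by rewrite normr_eq0 -unitfE -unitmxE us.
  apply: multiplicative_prekopa_leindler => //; try exact: borel_mulmx.
  move=> v w v0 w0; have vw0 i : 0 <= v ord0 i * w ord0 i.
    have := v0 i; have := w0 i; rewrite /= !in_itv/= !andbT => wi vi.
    by rewrite ltW// mulr_gt0.
  (* The two maps are adjoint inverses, so scalar products are preserved; they are nonnegative on
     the orthant, as [fg] requires. *)
  have vwE : dotp (v *m T) (w *m (invmx T)^T) = dotp v w.
    by rewrite !dotp_mulmx trmx_mul trmxK mulmxA mulmxK ?us.
  rewrite /F /G /H enorm_geo_mean// -EFinM -EFin_expe lee_fin -vwE.
  by apply: fg; rewrite vwE; apply: sumr_ge0.
set If := Rn_integral (fun x => (f x)%:E); set Ig := Rn_integral (fun y => (g y)%:E).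
have If0 : (0 <= If)%E by rewrite /If fE; exact: row_integral_ge0.
have Iff : If \is a fin_num by rewrite ge0_fin_numE.
(* Every piece has the same mass [2^-n If], so this factor can be distributed over the dual cones;
   each of the [2^n] resulting terms is at most [K ^+ 2]. *)
have half_le : ((2 ^- n)%:E * If * Ig <= (2 ^+ n)%:E * K ^+ 2)%E.
  apply: (@le_trans _ _ (\sum_(T <- s) ((2 ^- n)%:E * If *
      row_integral setT n (G \_ (image_orthant n (M T)))))%E).
    rewrite -ge0_sume_distrr; last first.
move=> T _; apply: row_integral_ge0 => v; exact: erestrict_ge0.
    apply: lee_wpmul2l; first by rewrite mule_ge0// lee_fin invr_ge0 exprn_ge0.
    rewrite -ge0_row_integral_sum; last 2 first.
    - by move=> T v; exact: erestrict_ge0.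
    - by move=> T; exact: borel_patch_image_orthant.
    rewrite /Ig Rn_integralE; apply: ge0_le_row_integral => //.
    apply: (borel_sum _ _ _ (fun T => G \_ (image_orthant n (M T)))) => T.
    exact: borel_patch_image_orthant.
  apply: (@le_trans _ _ (\sum_(T <- s) K ^+ 2)%E).
    rewrite big_seq [leRHS]big_seq; apply: lee_sum => T Ts.
    by rewrite -(pieceF _ Ts); exact: orthant_le.
  suff -> : (\sum_(T <- s) K ^+ 2 = (size s)%:R%:E * K ^+ 2)%E by rewrite size_s natrX.
  elim: (s) => [|T s' IH]; first by rewrite big_nil mul0e.
  by rewrite big_cons IH /= -natr1 addrC EFinD ge0_muleDl ?mul1e.
(* Restoring the factor [2^n] gives the bound [(2^n K)^2], the square of the full integral of
   [H]. *)
have -> : (If * Ig = (2 ^+ n)%:E * ((2 ^- n)%:E * If * Ig))%E.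
  by rewrite !muleA -EFinM divff ?mul1e// expf_eq0 pnatr_eq0 andbF.
rewrite HE expe2 [leRHS]muleACA -[leRHS]muleA.
by rewrite lee_pmul2l// lte_fin exprn_gt0.
Qed.
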